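(* Let $p\ge 5$ be a prime number and $d$ a divisor of $p-1$ with $1<d<p-1$. Let $K/k$ be a separable field extension of degree $pd$ whose Galois closure $\widetilde K$ has Galois group over $k$ isomorphic to the Frobenius group $F_{p(p-1)}$. Then: (1) $K/k$ has a Hopf Galois structure of type $C_{pd}$ (the cyclic group of order $pd$) which is not almost classically Galois and for which the Galois correspondence is bijective (one-to-one onto the set of intermediate fields of $K/k$). (2) $K/k$ has a Hopf Galois structure of type $F_{pd}$ for which the Galois correspondence is bijective, and which is almost classically Galois if and only if $\gcd((p-1)/d,d)=1$.
   Context: Frobenius groups: $F_{p(p-1)}=\left\{\begin{pmatrix}1&b\\0&c\end{pmatrix}: b\in\mathbf F_p,\ c\in\mathbf F_p^*\right\}\subset \mathrm{GL}(2,p)$, and for $d\mid p-1$, $F_{pd}$ is its subgroup of matrices with $c$ in the unique subgroup of order $d$ of $\mathbf F_p^*$. Hopf Galois structures: a finite extension $K/k$ is Hopf Galois if there is a finite cocommutative $k$-Hopf algebra $H$ such that $K$ is an $H$-module algebra and $j:K\otimes_kH\to\mathrm{End}_k(K)$, $j(s\otimes h)(t)=s(ht)$, is bijective; $H$ with its action is a Hopf Galois structure. Let $K/k$ be separable with Galois closure $\widetilde K$, $G=\mathrm{Gal}(\widetilde K/k)$, $G'=\mathrm{Gal}(\widetilde K/K)$, and $\lambda:G\to\mathrm{Perm}(G/G')$ left translation. By Greither–Pareigis, the Hopf Galois structures on $K/k$ correspond bijectively to the regular (simply transitive) subgroups $N$ of $\mathrm{Perm}(G/G')$ normalized by $\lambda(G)$: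 to $N$ corresponds $H=\widetilde K[N]^G$ (with $G$ acting on $\widetilde K$ naturally and on $N$ by conjugation through $\lambda$), acting on $x\in K$ by $\left(\sum_\tau a_\tau\tau\right)\cdot x=\sum_\tau a_\tau\,\tau^{-1}(\bar1)(x)$, where $\bar 1=G'$ and a coset $gG'$ acts by $x\mapsto g(x)$. The structure is of type $M$ if $N\cong M$. Galois correspondence: for a structure with Hopf algebra $H$, the Galois correspondence is the map sending a sub-Hopf algebra $H'$ of $H$ to $K^{H'}=\{x\in K: h\cdot x=\varepsilon(h)x\ \forall h\in H'\}$, an intermediate field of $K/k$; it is always injective. It is bijective if every intermediate field of $K/k$ is in its image. Almost classically Galois: $K/k$ is almost classically Galois if $G'$ has a normal complement in $G$, equivalently if there is a regular subgroup of $\mathrm{Perm}(G/G')$ normalized by $\lambda(G)$ and contained in $\lambda(G)$. The Hopf Galois structure given by $N$ is almost classically Galois if the centralizer of $N$ in $\mathrm{Perm}(G/G')$ is contained in $\lambda(G)$. *)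

(* Defs.v *)
From HB Require Import structures.
From mathcomp Require Import all_boot all_order all_fingroup all_algebra.
From mathcomp Require Import all_solvable all_field.

Set Implicit Arguments.
Unset Strict Implicit.
Unset Printing Implicit Defensive.

Import GRing.Theory.
Local Open Scope ring_scope.

(* U (x) V is modelled in coordinates: [tens] is the universal bilinear map
   from U x V, and [tens_lift f] is the linear map U (x) V -> W induced by a
   bilinear map f, as shown by [tens_lift_tens]. *)
Notation tens_type U V := 'M_(\dim {:U}, \dim {:V}).

Section Tensor.
Variables (k : fieldType) (U V : vectType k).

Definition tens (u : U) (v : V) : 'M[k]_(\dim {:U}, \dim {:V}) :=
  \matrix_(i, j) (coord (vbasis {:U}) i u * coord (vbasis {:V}) j v).

Definition tens_lift (W : lmodType k) (f : U -> V -> W)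
    (t : 'M[k]_(\dim {:U}, \dim {:V})) : W :=
  \sum_i \sum_j t i j *: f (vbasis {:U})`_i (vbasis {:V})`_j.

Lemma tens_lift_tens (W : lmodType k) (f : U -> V -> W) (u : U) (v : V) :
  (forall v, linear (f^~ v)) -> (forall u, linear (f u)) ->
  tens_lift f (tens u v) = f u v.
Proof.
move=> lf1 lf2.
have E (X : vectType k) (F : X -> W) (x : X) : linear F ->
    F x = \sum_i coord (vbasis {:X}) i x *: F (vbasis {:X})`_i.
  move=> lF.
  pose LF : {linear X -> W} := HB.pack F (GRing.isLinear.Build _ _ _ _ F lF).
  rewrite -[F]/(LF : _ -> _) {1}(coord_vbasis (memvf x)) linear_sum.
  by apply: eq_bigr => i _; rewrite linearZ.
rewrite (E _ (f^~ v) u) //; apply: eq_bigr => i _.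
rewrite (E _ (f _) v) // scaler_sumr; apply: eq_bigr => j _.
by rewrite mxE scalerA.
Qed.

Definition tensv (A : {vspace U}) (B : {vspace V}) :
    {vspace 'M[k]_(\dim {:U}, \dim {:V})} :=
  <<[seq tens a b | a <- vbasis A, b <- vbasis B]>>%VS.

End Tensor.

Record hopfAlg (k : fieldType) := HopfAlg {
  hopf_sort :> falgType k;
  comult : {linear hopf_sort -> tens_type hopf_sort hopf_sort};
  counit : {scalar hopf_sort};
  antipode : {linear hopf_sort -> hopf_sort};
  comultA : forall h,
    tens_lift (fun a b => tens_lift (fun a1 a2 => tens a1 (tens a2 b))
                                    (comult a)) (comult h)
    = tens_lift (fun a b => tens a (comult b)) (comult h);
  counitl : forall h, tens_lift (fun a b => counit a *: b) (comult h) = h;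
  counitr : forall h, tens_lift (fun a b => counit b *: a) (comult h) = h;
  comult1 : comult 1 = tens 1 1;
  comultM : forall g h, comult (g * h) =
    tens_lift (fun a b => tens_lift (fun a' b' => tens (a * a') (b * b'))
                                    (comult h)) (comult g);
  counit1 : counit 1 = 1;
  counitM : forall g h, counit (g * h) = counit g * counit h;
  antipodel : forall h,
    tens_lift (fun a b => antipode a * b) (comult h) = (counit h)%:A;
  antipoder : forall h,
    tens_lift (fun a b => a * antipode b) (comult h) = (counit h)%:A
}.

Arguments comult {k h0}.
Arguments counit {k h0}.
Arguments antipode {k h0}.

Definition cocommutative (k : fieldType) (H : hopfAlg k) : Prop :=
  forall h : H, tens_lift (fun a b => tens b a) (comult h) = comult h.

Definition is_subhopf (k : fieldType) (H : hopfAlg k) (A : {vspace H}) : Prop :=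
  [/\ 1 \in A,
      forall a b, a \in A -> b \in A -> a * b \in A,
      forall a, a \in A -> comult a \in tensv A A
    & forall a, a \in A -> antipode a \in A].

Definition hopf_galois_map (k : fieldType) (H : hopfAlg k)
    (K : fieldExtType k) (act : H -> 'End(K)) : tens_type K H -> 'End(K) :=
  tens_lift (fun (s : K) (h : H) => (amull s \o act h)%VF).

Record hopfGalois (k : fieldType) (H : hopfAlg k) (K : fieldExtType k) :=
  HopfGalois {
    hact :> {linear H -> 'End(K)};
    hact1 : forall x, hact 1 x = x;
    hactM : forall g h x, hact (g * h) x = hact g (hact h x);
    hact_unit : forall h, hact h 1 = (counit h)%:A;
    hact_mul : forall h x y, hact h (x * y) =
      tens_lift (fun a b => hact a x * hact b y) (comult h);
    hopf_cocomm : cocommutative H;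
    hopf_galois_bij : bijective (hopf_galois_map hact)
  }.

Section GaloisCorrespondence.
Variables (k : fieldType) (H : hopfAlg k) (K : fieldExtType k).
Variable S : hopfGalois H K.

Definition is_hopf_fixed (A : {vspace H}) (F : {subfield K}) : Prop :=
  forall x, x \in F <-> forall h, h \in A -> S h x = counit h *: x.

(* A |-> K^A is a bijection from the sub-Hopf algebras of H onto the
   intermediate fields of K/k. *)
Definition galois_corr_bijective : Prop :=
  (forall A : {vspace H}, is_subhopf A ->
     exists F : {subfield K}, is_hopf_fixed A F)
  /\ (forall F : {subfield K},
        exists! A : {vspace H}, is_subhopf A /\ is_hopf_fixed A F).

End GaloisCorrespondence.

Definition is_galois_closure (k : fieldType) (L : splittingFieldType k)
    (K : {subfield L}) : Prop :=
  galois 1 {:L} /\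
  forall E : {subfield L}, (K <= E)%VS -> galois 1 E -> E = {:L}%AS.

(* Both galM and permM read products from left to right: x * y means "x, then
   y", in gal_of as well as in {perm _}.  In this section the usual product
   g o h of automorphisms or permutations is therefore written h * g, the coset
   gG' = {g o h | h in G'} is the right coset G' :* g, and left translation by
   g sends G' :* h to G' :* h :* g. *)
Section GreitherPareigis.
Variables (k : fieldType) (L : splittingFieldType k) (K : {subfield L}).

Local Notation G := 'Gal({:L} / 1)%g.
Local Notation G' := 'Gal({:L} / K)%g.

Lemma mem_gal1 (g : gal_of {:L}) : g \in G.
Proof. by rewrite gal_kAut ?sub1v // kAut1E limg_gal. Qed.

Definition gcoset : finType := {X : {set gal_of {:L}} | X \in rcosets G' G}.

Fact coset1_subproof : (G' : {set _}) \in rcosets G' G.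
Proof. by apply/rcosetsP; exists 1%g; rewrite ?group1 ?rcoset1. Qed.
Definition coset1 : gcoset := exist _ (G' : {set _}) coset1_subproof.

Fact lambda_subproof (g : gal_of {:L}) (X : gcoset) :
  (val X :* g)%g \in rcosets G' G.
Proof.
case: X => _ /= /rcosetsP[h _ ->]; rewrite -rcosetM.
by apply/rcosetsP; exists (h * g)%g; rewrite ?mem_gal1.
Qed.
Definition lambda_fun g (X : gcoset) : gcoset :=
  exist _ (val X :* g)%g (lambda_subproof g X).
Fact lambda_inj g : injective (lambda_fun g).
Proof. by move=> X Y /(congr1 val) /= /rcoset_inj/val_inj. Qed.
Definition lambda g : {perm gcoset} := perm (@lambda_inj g).

(* gG' acts on K by x |-> g(x); the representative chosen only matters outside K. *)
Definition coset_act (X : gcoset) (x : L) : L := repr (val X) x.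

Implicit Type N : {group {perm gcoset}}.

Definition regular_subgroup N : Prop :=
  forall X Y : gcoset, exists! n, n \in N /\ n X = Y.

Definition normalized_by_lambda N : Prop := lambda @: G \subset 'N(N)%g.

(* Elements of the group algebra L[N] are functions f on Perm(G/G') vanishing
   outside N; G acts by g . (sum_n f(n) n) = sum_n g(f(n)) (n ^ lambda g). *)
Definition in_group_algebra N (f : {ffun {perm gcoset} -> L}) : Prop :=
  forall n, n \notin N -> f n = 0.

Definition in_fixed_group_algebra N (f : {ffun {perm gcoset} -> L}) : Prop :=
  in_group_algebra N f /\
  forall g, g \in G -> forall n, f (n ^ lambda g)%g = g (f n).

(* The Hopf Galois structure S is, up to isomorphism, the one given by N:
   phi is an isomorphism of Hopf algebras from H onto L[N]^G which carries the
   action of H on K to (sum_n f(n) n) . x = sum_n f(n) n^-1(coset1)(x). *)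
Definition given_by (H : hopfAlg k) (S : hopfGalois H (subvs_of K)) N : Prop :=
  [/\ regular_subgroup N, normalized_by_lambda N &
  exists phi : {linear H -> {ffun {perm gcoset} -> L}},
    [/\ injective phi,
        forall f, (exists h, phi h = f) <-> in_fixed_group_algebra N f &
    [/\ phi 1 = [ffun n => (n == 1%g)%:R],
        forall g h, phi (g * h) =
          [ffun n => \sum_(m in N) \sum_(l in N | n == (l * m)%g)
                       phi g m * phi h l],
        (* both sides lie in L[N] (x)_L L[N] = L[N x N] *)
        forall h m n, tens_lift (fun a b => phi a m * phi b n) (comult h) =
          if m == n then phi h n else 0,
        forall h, \sum_(n in N) phi h n = (counit h)%:A &
    [/\ forall h, phi (antipode h) = [ffun n => phi h n^-1%g]
      & forall h x, vsval (S h x) =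
          \sum_(n in N) phi h n * coset_act (n^-1%g coset1) (vsval x)]]]].

Definition almost_classical N : Prop := 'C(N)%g \subset lambda @: G.

End GreitherPareigis.

(* Matrices (1 b; 0 c) in GL(2,p) with c^d = 1: for d | p - 1, the condition on
   c defines the unique subgroup of order d of F_p^*, and Frob p (p - 1) is the
   full group F_{p(p-1)}. *)
Definition Frob_set (p d : nat) : {set {'GL_2(p)}} :=
  [set g : {'GL_2(p)} | [&& GLval g ord0 ord0 == 1, GLval g ord_max ord0 == 0
                          & GLval g ord_max ord_max ^+ d == 1]].

Fact Frob_group_set p d : group_set (Frob_set p d).
Proof.
apply/group_setP; split=> [|x y]; rewrite !inE.
  by rewrite GL_1E !mxE /= expr1n !eqxx.
case/and3P=> /eqP x0 /eqP x1 /eqP xd /and3P[/eqP y0 /eqP y1 /eqP yd].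
rewrite GL_MxE !mxE /= !big_ord_recl !big_ord0 /=.
have -> : lift ord0 ord0 = ord_max :> 'I_2 by apply/val_inj.
by rewrite x0 x1 y0 y1 !(mulr0, mul0r, addr0, add0r, mulr1) exprMn xd yd mulr1 !eqxx.
Qed.
Canonical Frob p d := Group (Frob_group_set p d).

(* Main.v *)
Require Import Defs.
From HB Require Import structures.
From mathcomp Require Import all_boot all_order all_fingroup all_algebra.
From mathcomp Require Import all_solvable all_field ring.

Set Implicit Arguments.
Unset Strict Implicit.
Unset Printing Implicit Defensive.

Import GRing.Theory.
Local Open Scope ring_scope.

(** Let G be the Galois group of L/k and G' the one of L/K. The proof combines
the existence part of Greither-Pareigis theory, with its Galois correspondence,
and an explicit family of regular subgroups of Perm(G/G').

Descent. Let lambda(G) normalize a regular subgroup N. By Dedekind's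
independence of automorphisms there are families w, c in L such that
sum_i c_i g(w_i) is 1 for g = 1 and 0 for the other g ([dual_family]). It
follows that the trace is nondegenerate, so that invariants of L[N] that are
independent over k remain independent over L ([descent_indep]), and that the
delta function at an element of N is an L-combination of invariants
([orbit_sum_dual]). Multiplication by an element of trace 1 followed by the
trace turns an L-linear expression of an invariant into a k-linear one
([trace_descent]). Thus tensors over H = L[N]^G are the same as invariant
functions on N x N ([tens_eval2_inj], [tens_eval2_surj]): the diagonal functions
define the comultiplication, and the axioms of a Hopf algebra can be checked by
evaluation at elements of N. The map K (x) H -> End(K) is injective, because
distinct cosets give independent embeddings of K in L, and it is bijective by
dimension ([hopfGalois_of_descent]).

Correspondence. The sub-Hopf algebras of H are the L[N']^G, for the subgroups N'
of N normalized by lambda(G) ([subhopf_supp_in]), and the fixed field of L[N']^G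
is that of the group of all g with gG' in the orbit of G' under N'
([hopf_fixedP]). By Galois theory of L/k, the correspondence is bijective as
soon as every group U between G' and G is obtained in this way
([galois_corr_of_stable]).

The family. Let m = (p - 1) / d, and let F_{p(p-1)} act on the affine line by
x |-> b + c x. The group G' consists of the elements that fix a point x0 and
satisfy c^m = 1, so a coset is determined by the image x of x0 and by y = c^m, a
d-th root of unity, and lambda(b, c) is (x, y) |-> (b + c x, c^m y). For every j
the maps (x, y) |-> (x + y^j a, w y) form a regular subgroup N_j normalized by
lambda(G). It is cyclic for j = 0 and isomorphic to F_{pd} for j prime to d, and
its centralizer is contained in lambda(G) exactly when m j = 1 modulo d
([shear_almost_classical]). A group U containing G' contains all translations or
fixes x0, and both kinds come from subgroups of N_j ([shear_stable]). The first
structure is that of N_0; the second one is that of N_j, where j is an inverse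
of m modulo d whenever there is one. *)

(** * Bilinear maps on the coordinate tensor product *)

Section TensorTheory.
Variables (k : fieldType) (U V : vectType k).

Lemma tens_lift_is_linear (W : lmodType k) (f : U -> V -> W) :
  linear (tens_lift f : tens_type U V -> W).
Proof.
move=> c s t; rewrite /tens_lift scaler_sumr -big_split; apply: eq_bigr => i _.
rewrite scaler_sumr -big_split; apply: eq_bigr => j _.
by rewrite !mxE scalerDl scalerA.
Qed.

HB.instance Definition _ (W : lmodType k) (f : U -> V -> W) :=
  GRing.isLinear.Build k (tens_type U V) W _ (tens_lift f)
    (tens_lift_is_linear f).

(** Identities between tensors are proved by pushing a linear evaluation map
through [tens_lift] down to the pure tensors. *)
Lemma linear_tens_lift (W W' : lmodType k) (F : {linear W -> W'})
    (f : U -> V -> W) t :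
  F (tens_lift f t) = tens_lift (fun a b => F (f a b)) t.
Proof.
rewrite /tens_lift linear_sum; apply: eq_bigr => i _.
by rewrite linear_sum; apply: eq_bigr => j _; rewrite linearZ.
Qed.

Lemma eq_tens_lift (W : lmodType k) (f g : U -> V -> W) t :
  (forall a b, f a b = g a b) -> tens_lift f t = tens_lift g t.
Proof.
by move=> fg; apply: eq_bigr => i _; apply: eq_bigr => j _; rewrite fg.
Qed.

Lemma tens_lift_sum (W : lmodType k) (I : Type) (r : seq I) (P : pred I)
    (f : I -> U -> V -> W) t :
  tens_lift (fun a b => \sum_(i <- r | P i) f i a b) t
    = \sum_(i <- r | P i) tens_lift (f i) t.
Proof.
rewrite /tens_lift [RHS]exchange_big; apply: eq_bigr => i _.
by rewrite exchange_big; apply: eq_bigr => j _; rewrite scaler_sumr.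
Qed.

Lemma tens_lift_mulr (A : algType k) (f : U -> V -> A) (y : A) t :
  tens_lift (fun a b => f a b * y) t = tens_lift f t * y.
Proof.
rewrite /tens_lift mulr_suml; apply: eq_bigr => i _.
by rewrite mulr_suml; apply: eq_bigr => j _; rewrite scalerAl.
Qed.

Lemma tens_lift_mull (A : algType k) (f : U -> V -> A) (y : A) t :
  tens_lift (fun a b => y * f a b) t = y * tens_lift f t.
Proof.
rewrite /tens_lift mulr_sumr; apply: eq_bigr => i _.
by rewrite mulr_sumr; apply: eq_bigr => j _; rewrite scalerAr.
Qed.

Lemma tens_linearl (v : V) : linear (fun u : U => tens u v).
Proof.
by move=> c x y; apply/matrixP=> i j; rewrite !mxE linearP mulrDl mulrA.
Qed.

Lemma tens_linearr (u : U) : linear (fun v : V => tens u v).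
Proof.
by move=> c x y; apply/matrixP=> i j; rewrite !mxE linearP mulrDr mulrCA.
Qed.

Lemma mem_tensv (A : {vspace U}) (B : {vspace V}) a b :
  a \in A -> b \in B -> tens a b \in tensv A B.
Proof.
move=> Aa Bb; rewrite (coord_vbasis Aa).
pose fl (v : V) : {linear U -> 'M[k]_(\dim {:U}, \dim {:V})} :=
  HB.pack (fun u => tens u v) (GRing.isLinear.Build _ _ _ _ _ (tens_linearl v)).
pose fr (u : U) : {linear V -> 'M[k]_(\dim {:U}, \dim {:V})} :=
  HB.pack (fun v => tens u v) (GRing.isLinear.Build _ _ _ _ _ (tens_linearr u)).
rewrite -[tens _ b]/(fl b _) linear_sum memv_suml // => i _.
rewrite linearZ memvZ //= (coord_vbasis Bb) -[tens _ _]/(fr _ _).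
rewrite linear_sum memv_suml // => j _; rewrite linearZ memvZ //= memv_span //.
by apply/allpairsP; exists ((vbasis A)`_i, (vbasis B)`_j); rewrite !memt_nth.
Qed.

Lemma tensvP (A : {vspace U}) (B : {vspace V}) t : t \in tensv A B ->
  exists s : 'I_(\dim A) -> 'I_(\dim B) -> k,
    t = \sum_i \sum_j s i j *: tens (vbasis A)`_i (vbasis B)`_j.
Proof.
pose S : {vspace 'M[k]_(\dim {:U}, \dim {:V})} :=
  (\sum_(i < \dim A) \sum_(j < \dim B) <[tens (vbasis A)`_i (vbasis B)`_j]>)%VS.
have sS : (tensv A B <= S)%VS.
  apply/span_subvP => _ /allpairsP[[a b] /= [Aa Bb ->]].
  have ia : (index a (vbasis A) < \dim A)%N by rewrite -{2}(size_tuple (vbasis A)) index_mem.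
  have ib : (index b (vbasis B) < \dim B)%N by rewrite -{2}(size_tuple (vbasis B)) index_mem.
  rewrite -(nth_index 0 Aa) -(nth_index 0 Bb) memvE.
  rewrite (subv_trans _ (sumv_sup (Ordinal ia) _ (subvv _))) //.
  by rewrite (subv_trans _ (sumv_sup (Ordinal ib) _ (subvv _))).
move/(subvP sS)/memv_sumP => [v Sv ->].
have w_ i : exists w : {ffun 'I_(\dim B) -> k},
    v i == \sum_j w j *: tens (vbasis A)`_i (vbasis B)`_j.
  have /memv_sumP[w Sw ->] := Sv i isT.
  have c_ j : exists c, w j == c *: tens (vbasis A)`_i (vbasis B)`_j.
    by have /vlineP[c ->] := Sw j isT; exists c.
  exists [ffun j => xchoose (c_ j)]; apply/eqP/eq_bigr => j _.
  by rewrite ffunE; apply/eqP/(xchooseP (c_ j)).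
exists (fun i j => (xchoose (w_ i) : {ffun _}) j); apply: eq_bigr => i _.
by apply/eqP/(xchooseP (w_ i)).
Qed.

End TensorTheory.

Section LinearLift.
Variables (k : fieldType) (U V W : vectType k).

(** Preimages can be chosen linearly as soon as they exist. In this way the
structure maps of a Hopf algebra of invariants come from their formulas on L[N]. *)
Lemma linear_lift (f : {linear U -> W}) (g : {linear V -> W}) :
    (forall v, exists u, f u = g v) ->
  exists h : {linear V -> U}, forall v, f (h v) = g v.
Proof.
move=> fg; exists ((linfun f)^-1 \o linfun g)%VF => v /=.
rewrite comp_lfunE -[f _](lfunE f) limg_lfunVK ?lfunE //=.
by have [u <-] := fg v; rewrite -(lfunE f) memv_img ?memvf.
Qed.

End LinearLift.

(** * The trace and Galois descent *)

Section Trace.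
Variables (k : fieldType) (L : splittingFieldType k).
Hypothesis galL : galois 1 {:L}.
Local Notation gT := (gal_of {:L}).

Lemma Gal_setT : ('Gal({:L} / 1) = [set: gT])%g.
Proof. by apply/setP=> g; rewrite mem_gal1 inE. Qed.

Lemma gal_mulE (g h : gT) x : (g * h)%g x = h (g x).
Proof. by rewrite galM ?memvf. Qed.

Definition tr (x : L) : L := \sum_(g : gT) g x.

Lemma gal_tr (g : gT) x : g (tr x) = tr x.
Proof.
rewrite /tr rmorph_sum [RHS](reindex_inj (mulIg g)).
by apply: eq_bigr => h _; rewrite gal_mulE.
Qed.

Lemma gal_fixed_alg x : (forall g : gT, g x = x) -> exists c : k, c%:A = x.
Proof.
move=> fx; suff /vlineP[c ->]: x \in 1%VS by exists c.
rewrite -(galois_fixedField galL).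
by apply/fixedFieldP; rewrite ?memvf // => g _.
Qed.

Lemma tr_alg x : exists c : k, c%:A == tr x.
Proof.
by have [g|c <-] := @gal_fixed_alg (tr x); [apply: gal_tr | exists c].
Qed.

Definition trk x : k := xchoose (tr_alg x).

Lemma trZ c x : tr (c *: x) = c *: tr x.
Proof. by rewrite /tr scaler_sumr; apply: eq_bigr => g _; rewrite linearZ. Qed.

Lemma trkE x : (trk x)%:A = tr x.
Proof. exact/eqP/(xchooseP (tr_alg x)). Qed.

Lemma trk_eq0 x : (trk x == 0) = (tr x == 0).
Proof. by rewrite -trkE scaler_eq0 oner_eq0 orbF. Qed.

(** Dedekind's theorem provides w with invertible matrix (g(w_i)); c is the
column of the inverse matrix that belongs to the identity. *)
Lemma dual_family : exists w c : 'I_#|[set: gT]| -> L,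
  forall g : gT, \sum_i c i * g (w i) = (g == 1%g)%:R.
Proof.
have [w _ [uM _ _]] := gal_matrix [set: gT].
set M := matrix_of_fun _ _ in uM.
have i0 : 1%g \in [set: gT] by rewrite inE.
exists (tnth w), (fun i => invmx M i (enum_rank_in i0 1%g)) => g.
transitivity ((M *m invmx M) (enum_rank_in i0 g) (enum_rank_in i0 1%g)).
  rewrite mxE; apply: eq_bigr => i _; rewrite mulrC; congr (_ * _).
  by rewrite mxE enum_rankK_in ?inE.
rewrite mulmxV // mxE; congr (nat_of_bool _)%:R.
by rewrite (can_in_eq (enum_rankK_in i0)) ?inE.
Qed.

Lemma tr_dual : exists w c : 'I_#|[set: gT]| -> L,
  forall x, x = \sum_i c i * tr (w i * x).
Proof.
have [w [c wc]] := dual_family; exists w, c => x.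
transitivity (\sum_(g : gT) (\sum_i c i * g (w i)) * g x).
  rewrite (bigD1 1%g) //= wc eqxx mul1r gal_id big1 ?addr0 // => g /negPf g1.
  by rewrite wc g1 mul0r.
under eq_bigr => g _ do rewrite mulr_suml.
rewrite exchange_big; apply: eq_bigr => i _ /=.
by rewrite mulr_sumr; apply: eq_bigr => g _; rewrite rmorphM mulrA.
Qed.

Lemma tr_nondeg x : (forall y, tr (y * x) = 0) -> x = 0.
Proof.
move=> trx; have [w [c dualE]] := tr_dual; rewrite (dualE x).
by rewrite big1 // => i _; rewrite trx mulr0.
Qed.

(** As 1 is an L-combination of traces by [tr_dual], some trace is nonzero. *)
Lemma tr_surj : exists y, tr y = 1.
Proof.
have [w [c /(_ 1) dual1]] := tr_dual.
have [/existsP[i nzi] | /existsPn none] := boolP [exists i, trk (w i) != 0].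
  exists ((trk (w i))^-1 *: w i).
  by rewrite trZ -trkE scalerA mulVf // scale1r.
case/eqP: (oner_neq0 L); rewrite dual1 big1 // => i _.
by have /negPn := none i; rewrite trk_eq0 mulr1 => /eqP->; rewrite mulr0.
Qed.

Section Descent.
Variables (X : Type) (act : gT -> X -> X).
Hypothesis actK : forall g x, act g (act g^-1%g x) = x.

Definition equivariant (f : X -> L) := forall g x, f (act g x) = g (f x).

(** This is where coefficients descend from L to k: multiply an L-linear
expression of an invariant through invariants by y, and sum its conjugates. If y
has trace 1, then the invariant itself is recovered on the left. *)
Lemma trace_descent (I : finType) (l : I -> L) (a : I -> X -> L) f :
    equivariant f -> (forall i, equivariant (a i)) ->
    (forall x, f x = \sum_i l i * a i x) ->
  forall y x, tr y * f x = \sum_i trk (y * l i) *: a i x.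
Proof.
move=> ef ea fl y x.
under [RHS]eq_bigr => i _ do rewrite -mulr_algl trkE /tr mulr_suml.
rewrite exchange_big mulr_suml; apply: eq_bigr => g _ /=.
rewrite -{1}(actK g x) ef fl -rmorphM mulr_sumr rmorph_sum.
by apply: eq_bigr => i _; rewrite mulrA rmorphM /= -(ea i g) actK.
Qed.

(** By [trace_descent] the traces of all the multiples of l_i vanish, and the
trace is nondegenerate. *)
Lemma descent_indep (I : finType) (l : I -> L) (a : I -> X -> L) :
    (forall i, equivariant (a i)) ->
    (forall c : I -> k, (forall x, \sum_i c i *: a i x = 0) -> forall i, c i = 0) ->
  (forall x, \sum_i l i * a i x = 0) -> forall i, l i = 0.
Proof.
move=> ea freea la0 i; apply: tr_nondeg => y; apply/eqP; rewrite -trk_eq0.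
apply/eqP; move: i; apply: freea => x.
rewrite -(@trace_descent I l a (fun=> 0)) ?mulr0 // => g z.
by rewrite raddf0.
Qed.

End Descent.

End Trace.

(** * The group algebra with coefficients in an algebra *)

Section GroupAlgebra.
Variables (k : fieldType) (A : falgType k) (gT : finGroupType).

Definition grpalg := {ffun gT -> A}.
HB.instance Definition _ := Vector.on grpalg.
Implicit Types f g h : grpalg.

(** The value at n = l * m collects f m * g l: as products of permutations are
read from left to right, l * m is the usual product m o l. *)
Definition conv f g : grpalg := [ffun n => \sum_m f m * g (n * m^-1)%g].
Definition conv1 : grpalg := [ffun n => (n == 1%g)%:R].

Lemma conv1l : left_id conv1 conv.
Proof.
move=> f; apply/ffunP=> n; rewrite ffunE (bigD1 1%g) //= !ffunE eqxx mul1r.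
rewrite invg1 mulg1 big1 ?addr0 // => m /negPf m1.
by rewrite ffunE m1 mul0r.
Qed.

Lemma conv1r : right_id conv1 conv.
Proof.
move=> f; apply/ffunP=> n; rewrite ffunE (bigD1 n) //= !ffunE mulgV eqxx mulr1.
rewrite big1 ?addr0 // => m /negPf mn.
by rewrite ffunE -eq_mulgV1 eq_sym mn mulr0.
Qed.

Lemma convA : associative conv.
Proof.
move=> f g h; apply/ffunP=> n; rewrite !ffunE.
under eq_bigr => m _ do rewrite ffunE mulr_sumr (reindex_inj (mulIg m^-1%g)).
rewrite exchange_big; apply: eq_bigr => m _ /=; rewrite ffunE mulr_suml.
apply: eq_bigr => l _; rewrite mulrA invMg invgK; congr (_ * h _).
by rewrite -!mulgA mulKg.
Qed.

Lemma convDl : left_distributive conv +%R.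
Proof.
move=> f g h; apply/ffunP=> n; rewrite !ffunE -big_split.
by apply: eq_bigr => m _; rewrite ffunE mulrDl.
Qed.

Lemma convDr : right_distributive conv +%R.
Proof.
move=> f g h; apply/ffunP=> n; rewrite !ffunE -big_split.
by apply: eq_bigr => m _; rewrite ffunE mulrDr.
Qed.

Lemma conv1_neq0 : conv1 != 0.
Proof.
apply/eqP=> /ffunP/(_ 1%g); rewrite !ffunE eqxx => /eqP.
by rewrite oner_eq0.
Qed.

HB.instance Definition _ := GRing.Zmodule_isNzRing.Build grpalg
  convA conv1l conv1r convDl convDr conv1_neq0.

Lemma conv_scalel (c : k) f g : c *: (f * g) = (c *: f) * g.
Proof.
apply/ffunP=> n; rewrite !ffunE scaler_sumr.
by apply: eq_bigr => m _; rewrite ffunE scalerAl.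
Qed.

HB.instance Definition _ := GRing.Lmodule_isLalgebra.Build k grpalg conv_scalel.

Lemma conv_scaler (c : k) f g : c *: (f * g) = f * (c *: g).
Proof.
apply/ffunP=> n; rewrite !ffunE scaler_sumr.
by apply: eq_bigr => m _; rewrite ffunE scalerAr.
Qed.

HB.instance Definition _ := GRing.Lalgebra_isAlgebra.Build k grpalg conv_scaler.
HB.instance Definition _ := Algebra_isFalgebra.Build k grpalg.

End GroupAlgebra.

(** * The invariants of a group algebra *)

Section TensorEval.
Variables (k : fieldType) (L : splittingFieldType k).
Variables (U V : vectType k) (X Y : finType).
Variables (phi : {linear U -> {ffun X -> L}}).
Variables (psi : {linear V -> {ffun Y -> L}}).

(** Tensors over k are compared through these values in L. *)
Definition tens_eval (t : tens_type U V) : {ffun X * Y -> L} :=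
  [ffun p => tens_lift (fun a b => phi a p.1 * psi b p.2) t].

Lemma tens_eval_is_linear : linear tens_eval.
Proof. by move=> c s t; apply/ffunP=> p; rewrite !ffunE linearP. Qed.

HB.instance Definition _ := GRing.isLinear.Build k (tens_type U V)
  {ffun X * Y -> L} _ tens_eval tens_eval_is_linear.

Lemma tens_eval_tens a b x y : tens_eval (tens a b) (x, y) = phi a x * psi b y.
Proof.
rewrite ffunE (@tens_lift_tens _ _ _ _ (fun a b => phi a x * psi b y)) //.
  by move=> v c u u'; rewrite linearP !ffunE mulrDl scalerAl.
by move=> u c v v'; rewrite linearP !ffunE mulrDr scalerAr.
Qed.

(** Independence over L in the first variable leaves, for each basis vector of
U, a vector of V killed by psi. As V only has to be separated over k, the lemma
can be iterated. *)
Lemma tens_eval_inj :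
    (forall l : 'I_(\dim {:U}) -> L,
       (forall x, \sum_i l i * phi (vbasis {:U})`_i x = 0) ->
       forall i, l i = 0) ->
  injective psi -> injective tens_eval.
Proof.
move=> indep psi_inj s t /eqP; rewrite -subr_eq0 -linearB => /eqP st0.
apply/eqP; rewrite -subr_eq0; apply/eqP; move: (s - t) st0 => {s t} t t0.
have t0i i : \sum_j t i j *: (vbasis {:V})`_j = 0.
  apply: psi_inj; rewrite raddf0; apply/ffunP=> y; rewrite [RHS]ffunE.
  move: i; apply: indep => x; have /ffunP/(_ (x, y)) := t0.
  rewrite !ffunE => e0; rewrite -[RHS]e0; apply: eq_bigr => i _ /=.
  rewrite linear_sum sum_ffunE mulr_suml; apply: eq_bigr => j _.
  by rewrite linearZ ffunE -scalerAl [X in t i j *: X]mulrC.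
apply/matrixP=> i j; rewrite !mxE.
have /freeP := basis_free (vbasisP {:V}).
by move/(_ (fun j => t i j)); apply; apply: t0i.
Qed.

End TensorEval.

Section FixedGroupAlgebra.
Variables (k : fieldType) (L : splittingFieldType k).
Hypothesis galL : galois 1 {:L}.
Variables (gT : finGroupType) (lam : gal_of {:L} -> gT).
Hypothesis lamM : {morph lam : g h / (g * h)%g}.
Variable N : {group gT}.
Hypothesis normN : forall g, lam g \in 'N(N)%g.

Lemma lam1 : lam 1%g = 1%g.
Proof. by apply: (mulgI (lam 1%g)); rewrite -lamM !mulg1. Qed.

Lemma conj_lamK g n : ((n ^ lam g^-1) ^ lam g)%g = n.
Proof. by rewrite -conjgM -lamM mulVg lam1 conjg1. Qed.

Lemma memN_lam g n : ((n ^ lam g)%g \in N) = (n \in N).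
Proof. by rewrite memJ_norm. Qed.

Local Notation eqv :=
  (equivariant (fun (g : gal_of {:L}) (n : gT) => (n ^ lam g)%g)).
Local Notation eqv2 :=
  (equivariant (fun (g : gal_of {:L}) (p : gT * gT) =>
                  ((p.1 ^ lam g)%g, (p.2 ^ lam g)%g))).

Definition fixed_alg (f : {ffun gT -> L}) :=
  (forall n, n \notin N -> f n = 0) /\ eqv f.

(** The trace of l [n], for the semilinear action of the Galois group on the
group algebra. *)
Definition orbit_sum n (l : L) : {ffun gT -> L} :=
  [ffun m => \sum_(g : gal_of {:L}) (if (n ^ lam g == m)%g then g l else 0)].

Lemma orbit_sum_eqv n l : eqv (orbit_sum n l).
Proof.
move=> h m; rewrite !ffunE rmorph_sum (reindex_inj (mulIg h)).
apply: eq_bigr => g _ /=; rewrite lamM conjgM (inj_eq (conjg_inj _)).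
by case: ifP => _; rewrite ?gal_mulE // raddf0.
Qed.

Lemma orbit_sum_supp n l m :
  orbit_sum n l m != 0 -> exists g, m = (n ^ lam g)%g.
Proof.
rewrite ffunE => nz; have [/existsP[g /eqP]|/existsPn none] :=
  boolP [exists g, (n ^ lam g == m)%g]; first by exists g.
by case/eqP: nz; rewrite big1 // => g _; rewrite (negPf (none g)).
Qed.

(** The invariants span the group algebra over L: the families of [dual_family]
single out the term g = 1 of the orbit sums. *)
Lemma orbit_sum_dual : exists w c : 'I_#|[set: gal_of {:L}]| -> L,
  forall n m, \sum_i c i * orbit_sum n (w i) m = (n == m)%:R.
Proof.
have [w [c wc]] := dual_family L; exists w, c => n m.
under eq_bigr => i _ do rewrite ffunE mulr_sumr.
rewrite exchange_big (bigD1 1%g) //= lam1 conjg1 [X in _ + X]big1 ?addr0.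
  case: (n == m); last by apply: big1 => i _; rewrite mulr0.
  by rewrite (wc 1%g) eqxx.
move=> g /negPf g1; case: (_ == m); first by rewrite (wc g) g1.
by rewrite big1 // => i _; rewrite mulr0.
Qed.

Section Phi.
Variables (H : vectType k) (phi : {linear H -> {ffun gT -> L}}).
Hypothesis phi_inj : injective phi.
Hypothesis phi_im : forall f, (exists h, phi h = f) <-> fixed_alg f.

Lemma phi_out h n : n \notin N -> phi h n = 0.
Proof. by have [+ _] := (phi_im (phi h)).1 (ex_intro _ h erefl); apply. Qed.

Lemma phi_eqv h : eqv (phi h).
Proof. by have [_] := (phi_im (phi h)).1 (ex_intro _ h erefl). Qed.

Lemma fixed_alg_indep (A : {vspace H}) (l : 'I_(\dim A) -> L) :
  (forall n, \sum_i l i * phi (vbasis A)`_i n = 0) -> forall i, l i = 0.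
Proof.
apply: (descent_indep galL conj_lamK) => [i|c c0]; first exact: phi_eqv.
have /freeP := basis_free (vbasisP A); move/(_ c); apply.
apply: phi_inj; rewrite raddf0; apply/ffunP=> n; rewrite ffunE -[RHS](c0 n).
by rewrite linear_sum sum_ffunE; apply: eq_bigr => i _; rewrite linearZ ffunE.
Qed.

Lemma tens_eval2_inj : injective (tens_eval phi phi).
Proof. by apply: tens_eval_inj => //; apply: fixed_alg_indep. Qed.

Lemma tens_eval3_inj : injective (tens_eval phi (tens_eval phi phi)).
Proof. by apply: tens_eval_inj; [apply: fixed_alg_indep | apply: tens_eval2_inj]. Qed.

(** The space of invariants L[S]^G. *)
Definition supp_in (S : {set gT}) : {vspace H} :=
  lker (linfun (fun h : H => [ffun n => (n \notin S)%:R *: phi h n : L])).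

Lemma supp_in_linear (S : {set gT}) :
  linear (fun h : H => [ffun n => (n \notin S)%:R *: phi h n : L]).
Proof.
move=> c g h; apply/ffunP=> n; rewrite !ffunE linearP !ffunE.
by rewrite scalerDr !scalerA mulrC.
Qed.

Lemma supp_inP (S : {set gT}) h :
  reflect (forall n, n \notin S -> phi h n = 0) (h \in supp_in S).
Proof.
pose F : {linear H -> {ffun gT -> L}} := HB.pack
  (fun h : H => [ffun n => (n \notin S)%:R *: phi h n : L])
  (GRing.isLinear.Build _ _ _ _ _ (supp_in_linear S)).
rewrite memv_ker -[linfun _]/(linfun F) lfunE /=.
apply: (iffP eqP) => [/ffunP F0 n nS | h0].
  by have := F0 n; rewrite !ffunE nS scale1r.
apply/ffunP=> n; rewrite !ffunE; have [/h0->|_] := boolP (n \notin S).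
  by rewrite scaler0.
by rewrite scale0r.
Qed.

Lemma phi_orbit_sum n l : n \in N -> exists h, phi h = orbit_sum n l.
Proof.
move=> Nn; apply/phi_im; split; last exact: orbit_sum_eqv.
move=> m Nm; apply/eqP; apply: contraNT Nm => /orbit_sum_supp[g ->].
by rewrite memN_lam.
Qed.

Lemma orbit_sum_supp_in (S : {set gT}) :
    S \subset N -> (forall g n, n \in S -> (n ^ lam g)%g \in S) ->
  forall n l, n \in S -> exists2 h, h \in supp_in S & phi h = orbit_sum n l.
Proof.
move=> sSN stS n l Sn; have [h hE] := phi_orbit_sum l (subsetP sSN n Sn).
exists h => //; apply/supp_inP => m; apply: contraNeq.
by rewrite hE => /orbit_sum_supp[g ->]; apply: stS.
Qed.

(** Write F as the sum of the F(m, n) times products of delta functions,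
express the latter through orbit sums by [orbit_sum_dual], and make the
coefficients descend to k. Sub-Hopf algebras require the control of supports: the
orbit sums of elements of S belong to L[S]^G. *)
Lemma tens_eval2_surj (S : {set gT}) (F : gT * gT -> L) :
    S \subset N -> (forall g n, n \in S -> (n ^ lam g)%g \in S) ->
    eqv2 F -> (forall p, F p != 0 -> (p.1 \in S) && (p.2 \in S)) ->
  exists2 t, t \in tensv (supp_in S) (supp_in S) &
    forall p, tens_eval phi phi t p = F p.
Proof.
move=> sSN stS eF suppF.
have [y y_tr1] := tr_surj galL; have [w [c wc]] := orbit_sum_dual.
have /fin_all_exists[h hP] : forall ni : gT * 'I_#|[set: gal_of {:L}]|,
    exists h, h \in supp_in S /\
      (ni.1 \in S -> phi h = orbit_sum ni.1 (w ni.2)).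
  move=> [n i] /=; have [Sn|nSn] := boolP (n \in S).
    by have [h hS hE] := orbit_sum_supp_in sSN stS (w i) Sn; exists h.
  by exists 0; rewrite mem0v.
(* The index q = (m, n, i, j) stands for the term of F built from the delta
   functions at m and n and from the i-th and j-th orbit sums. *)
pose l q := let: (m, n, i, j) := q in F (m, n) * (c i * c j).
pose b q := let: (m, n, i, j) := q in
  fun p : gT * gT => phi (h (m, i)) p.1 * phi (h (n, j)) p.2.
pose T q := let: (m, n, i, j) := q in tens (h (m, i)) (h (n, j)).
have actK2 g p : ((((p.1 ^ lam g^-1)%g, (p.2 ^ lam g^-1)%g).1 ^ lam g)%g,
   (((p.1 ^ lam g^-1)%g, (p.2 ^ lam g^-1)%g).2 ^ lam g)%g) = p :> gT * gT.
  by case: p => m n /=; rewrite !conj_lamK.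
have eb q : eqv2 (b q).
  by case: q => [[[m n] i] j] g [u v] /=; rewrite !phi_eqv rmorphM.
have Fb p : F p = \sum_q l q * b q p.
  case: p => u v.
  transitivity (\sum_p \sum_i \sum_j l (p, i, j) * b (p, i, j) (u, v)); last first.
    by rewrite !pair_bigA; apply: eq_bigr => -[[[m n] i] j].
  transitivity (\sum_(p : gT * gT)
     F p * ((\sum_i c i * orbit_sum p.1 (w i) u)
             * (\sum_j c j * orbit_sum p.2 (w j) v))).
    rewrite (bigD1 (u, v)) //= !wc !eqxx !mulr1 big1 ?addr0 // => -[m n].
    rewrite xpair_eqE negb_and !wc /= => /orP[] /negPf->.
      by rewrite mul0r mulr0.
    by rewrite !mulr0.
  apply: eq_bigr => -[m n] _ /=.
  have [F0|nzF] := eqVneq (F (m, n)) 0.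
    by rewrite F0 mul0r big1 // => i _; rewrite big1 // => j _; rewrite !mul0r.
  have /andP[/= Sm Sn] := suppF _ nzF.
  rewrite mulr_suml mulr_sumr; apply: eq_bigr => i _.
  rewrite !mulr_sumr; apply: eq_bigr => j _.
  rewrite (hP (m, i)).2 // (hP (n, j)).2 //= -[RHS]mulrA; congr (_ * _).
  exact: mulrACA.
exists (\sum_q trk galL (y * l q) *: T q).
  apply: memv_suml => -[[[m n] i] j] _; apply: memvZ.
  by apply: mem_tensv; apply: (hP (_, _)).1.
move=> p; rewrite linear_sum sum_ffunE -[RHS]mul1r -y_tr1.
rewrite (trace_descent galL actK2 eF eb Fb).
apply: eq_bigr => -[[[m n] i] j] _; rewrite linearZ [LHS]ffunE /=.
by case: p => u v; rewrite tens_eval_tens.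
Qed.

(** The matrix of the values of a basis has a left inverse, because the delta
functions are combinations of invariants. *)
Lemma card_le_dim_fixed_alg : (#|N| <= \dim {:H})%N.
Proof.
have [w [c wc]] := orbit_sum_dual.
have /fin_all_exists[h hP] : forall ni : gT * 'I_#|[set: gal_of {:L}]|,
    exists h, ni.1 \in N -> phi h = orbit_sum ni.1 (w ni.2).
  move=> [n i] /=; have [Nn|nNn] := boolP (n \in N); last by exists 0.
  by have [h hE] := phi_orbit_sum (w i) Nn; exists h.
pose B : 'M[L]_(\dim {:H}, #|N|) :=
  \matrix_(j, n) phi (vbasis {:H})`_j (enum_val n).
pose C : 'M[L]_(#|N|, \dim {:H}) :=
  \matrix_(n, j) \sum_i c i * (coord (vbasis {:H}) j (h (enum_val n, i)))%:A.
have CB : C *m B = 1%:M.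
  apply/matrixP=> n m; rewrite !mxE.
  transitivity (\sum_i c i * phi (h (enum_val n, i)) (enum_val m)).
    under eq_bigr => j _ do rewrite !mxE mulr_suml.
    rewrite exchange_big; apply: eq_bigr => i _ /=.
    rewrite {2}(coord_vbasis (memvf (h (enum_val n, i)))) linear_sum sum_ffunE.
    rewrite mulr_sumr; apply: eq_bigr => j _.
    by rewrite linearZ ffunE -mulrA mulr_algl.
  under eq_bigr => i _ do rewrite hP ?enum_valP //=.
  by rewrite wc (inj_eq enum_val_inj).
have := mxrank1 L #|N|; rewrite -CB => <-.
exact: leq_trans (mxrankM_maxr _ _) (rank_leq_row _).
Qed.

End Phi.
End FixedGroupAlgebra.

(** * The Hopf algebra of invariants *)

Section HopfDescent.
Variables (k : fieldType) (L : splittingFieldType k).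
Hypothesis galL : galois 1 {:L}.
Variables (gT : finGroupType) (lam : gal_of {:L} -> gT).
Hypothesis lamM : {morph lam : g h / (g * h)%g}.
Variable N : {group gT}.
Hypothesis normN : forall g, lam g \in 'N(N)%g.

(** Up to the isomorphism psi, HH is the Hopf algebra L[N]^G, in which each
element of N is group-like. *)
Definition presents_fixed_alg (HH : hopfAlg k)
    (psi : {linear HH -> {ffun gT -> L}}) : Prop :=
  [/\ injective psi, forall f, (exists h, psi h = f) <-> fixed_alg lam N f &
  [/\ psi 1 = [ffun n => (n == 1%g)%:R],
      forall g h n, psi (g * h) n = \sum_m psi g m * psi h (n * m^-1)%g,
      forall h m n,
        tens_eval psi psi (comult h) (m, n) = if m == n then psi h n else 0,
      forall h, (counit h)%:A = \sum_n psi h n &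
      forall h n, psi (antipode h) n = psi h n^-1%g]].

Section FromAlgebra.
Variables (H : falgType k) (phi : {linear H -> {ffun gT -> L}}).
Hypothesis phi_inj : injective phi.
Hypothesis phi_im : forall f, (exists h, phi h = f) <-> fixed_alg lam N f.
Hypothesis phi1 : phi 1 = [ffun n => (n == 1%g)%:R].
Hypothesis phiM : forall g h n,
  phi (g * h) n = \sum_m phi g m * phi h (n * m^-1)%g.

Local Notation ev2 := (tens_eval phi phi).
Local Notation ev3 := (tens_eval phi (tens_eval phi phi)).
Let ev2_inj := tens_eval2_inj galL lamM phi_inj phi_im.
Let ev3_inj := tens_eval3_inj galL lamM phi_inj phi_im.

(** The comultiplication sends sum_n f(n) n to sum_n f(n) n (x) n, which is an
invariant function on N x N supported on the diagonal. *)
Lemma comult_exists :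
  exists D : {linear H -> tens_type H H},
    forall h m n, ev2 (D h) (m, n) = if m == n then phi h n else 0.
Proof.
pose Df (h : H) := [ffun p : gT * gT => if p.1 == p.2 then phi h p.2 else 0].
have lin_Df : linear Df.
  move=> c g h; apply/ffunP=> p; rewrite !ffunE linearP !ffunE.
  by case: ifP; rewrite // scaler0 addr0.
pose DF : {linear H -> {ffun gT * gT -> L}} :=
  HB.pack Df (GRing.isLinear.Build _ _ _ _ _ lin_Df).
have [h|D DE] := @linear_lift _ _ _ _ (ev2 : {linear _ -> _}) DF; last first.
  by exists D => h m n; rewrite DE ffunE.
have [||||t _ tE] := @tens_eval2_surj _ _ galL _ _ lamM _ normN _ _ phi_im N (Df h).
- by [].
- by move=> g n; rewrite memJ_norm.
- move=> g [m n] /=; rewrite !ffunE /= (inj_eq (conjg_inj _)).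
  by case: ifP => _; rewrite ?raddf0 // (phi_eqv phi_im).
- move=> [m n]; rewrite ffunE /=; have [->|_] := eqVneq m n; last by rewrite eqxx.
  by rewrite andbb; apply: contraNT => /(phi_out phi_im)->.
by exists t; apply/ffunP=> p; rewrite tE.
Qed.

(** Conjugation only permutes the terms of the sum, which is therefore in k. *)
Lemma counit_exists :
  exists e : {scalar H}, forall h, (e h)%:A = \sum_n phi h n.
Proof.
have ex h : exists c : k, c%:A == \sum_n phi h n.
  have [g|c <-] := gal_fixed_alg galL (x := \sum_n phi h n); last by exists c.
  rewrite rmorph_sum [RHS](reindex_inj (conjg_inj (lam g))).
  by apply: eq_bigr => n _; rewrite (phi_eqv phi_im).
pose e h := xchoose (ex h).
have eE h : (e h)%:A = \sum_n phi h n by apply/eqP/(xchooseP (ex h)).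
have lin_e : scalar e.
  move=> c g h; apply: (fmorph_inj (in_alg L)).
  rewrite rmorphD rmorphM /= !eE mulr_algl scaler_sumr -big_split.
  by apply: eq_bigr => n _; rewrite linearP !ffunE.
pose E : {scalar H} := HB.pack e (GRing.isLinear.Build _ _ _ _ _ lin_e).
by exists E.
Qed.

Lemma antipode_exists :
  exists S : {linear H -> H}, forall h n, phi (S h) n = phi h n^-1%g.
Proof.
pose Sf (h : H) := [ffun n : gT => phi h n^-1%g].
have lin_Sf : linear Sf.
  by move=> c g h; apply/ffunP=> p; rewrite !ffunE linearP !ffunE.
pose SF : {linear H -> {ffun gT -> L}} :=
  HB.pack Sf (GRing.isLinear.Build _ _ _ _ _ lin_Sf).
have [h|S SE] := @linear_lift _ _ _ _ phi SF; last first.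
  by exists S => h n; rewrite SE ffunE.
apply/phi_im; split=> [n Nn|g n]; rewrite !ffunE.
  by rewrite (phi_out phi_im) ?groupV.
by rewrite -conjVg (phi_eqv phi_im).
Qed.

(** Each axiom is an equality of invariants or of tensors, hence of values at
elements of the group, and there the comultiplication is diagonal. *)
Lemma hopfAlg_exists :
  exists (HH : hopfAlg k) (psi : {linear HH -> {ffun gT -> L}}),
  presents_fixed_alg psi.
Proof.
have [D DE] := comult_exists; have [e eE] := counit_exists.
have [S SE] := antipode_exists.
have DE' h m n : tens_lift (fun a b => phi a m * phi b n) (D h)
    = if m == n then phi h n else 0 by rewrite -DE ffunE.
have phi_tl (U V : vectType k) (f : U -> V -> H) t n :
    phi (tens_lift f t) n = tens_lift (fun a b => phi (f a b) n) t.
  rewrite linear_tens_lift /tens_lift sum_ffunE; apply: eq_bigr => i _.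
  by rewrite sum_ffunE; apply: eq_bigr => j _; rewrite ffunE.
have ev2_tl (U V : vectType k) (f : U -> V -> tens_type H H) t p :
    ev2 (tens_lift f t) p = tens_lift (fun a b => ev2 (f a b) p) t.
  rewrite linear_tens_lift /tens_lift sum_ffunE; apply: eq_bigr => i _.
  by rewrite sum_ffunE; apply: eq_bigr => j _; rewrite ffunE.
have ev3_tl (U V : vectType k) (f : U -> V -> tens_type H (tens_type H H)) t p :
    ev3 (tens_lift f t) p = tens_lift (fun a b => ev3 (f a b) p) t.
  rewrite linear_tens_lift /tens_lift sum_ffunE; apply: eq_bigr => i _.
  by rewrite sum_ffunE; apply: eq_bigr => j _; rewrite ffunE.
have axA h : tens_lift (fun a b => tens_lift (fun a1 a2 => tens a1 (tens a2 b))
                                    (D a)) (D h)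
    = tens_lift (fun a b => tens a (D b)) (D h).
  apply: ev3_inj; apply/ffunP=> -[m [n l]]; rewrite !ev3_tl.
  transitivity (if m == n then if n == l then phi h l else 0 else 0).
    rewrite (@eq_tens_lift _ _ _ _ _ (fun a b => (if m == n then phi a n else 0) * phi b l)).
      case: eqP => _; first exact: DE'.
      by rewrite tens_lift_mull mul0r.
    move=> a b; rewrite ev3_tl -DE' -tens_lift_mulr.
    by apply: eq_tens_lift => a1 a2; rewrite !tens_eval_tens mulrA.
  rewrite (@eq_tens_lift _ _ _ _ _ (fun a b => phi a m * (if n == l then phi b l else 0))).
    have [->|_] := eqVneq n l; first by rewrite DE'; case: (m == l).
    by rewrite tens_lift_mulr mulr0 if_same.
  by move=> a b; rewrite tens_eval_tens DE.
have axl h : tens_lift (fun a b => e a *: b) (D h) = h.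
  apply: phi_inj; apply/ffunP=> n; rewrite phi_tl.
  rewrite (@eq_tens_lift _ _ _ _ _ (fun a b => \sum_m phi a m * phi b n)).
    rewrite tens_lift_sum (bigD1 n) //= DE' eqxx big1 ?addr0 // => m /negPf mn.
    by rewrite DE' mn.
  by move=> a b; rewrite linearZ ffunE -mulr_algl eE mulr_suml.
have axr h : tens_lift (fun a b => e b *: a) (D h) = h.
  apply: phi_inj; apply/ffunP=> n; rewrite phi_tl.
  rewrite (@eq_tens_lift _ _ _ _ _ (fun a b => \sum_m phi a n * phi b m)).
    rewrite tens_lift_sum (bigD1 n) //= DE' eqxx big1 ?addr0 // => m /negPf mn.
    by rewrite DE' eq_sym mn.
  move=> a b; rewrite linearZ ffunE -mulr_algl eE mulr_suml.
  by apply: eq_bigr => m _; rewrite mulrC.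
have ax1 : D 1 = tens 1 1.
  apply: ev2_inj; apply/ffunP=> -[m n]; rewrite DE tens_eval_tens phi1 !ffunE.
  have [->|_] := eqVneq n 1%g; last by rewrite mulr0 if_same.
  by rewrite mulr1; case: (m == 1%g).
have axM g h : D (g * h) = tens_lift (fun a b => tens_lift (fun a' b' =>
    tens (a * a') (b * b')) (D h)) (D g).
  apply: ev2_inj; apply/ffunP=> -[m n]; rewrite DE ev2_tl.
  rewrite (@eq_tens_lift _ _ _ _ _ (fun a b => \sum_u \sum_v
    (phi a u * phi b v) * (if (m * u^-1 == n * v^-1)%g then phi h (n * v^-1)%g else 0))).
    rewrite tens_lift_sum.
    under eq_bigr => u _.
      rewrite tens_lift_sum (bigD1 u) //= tens_lift_mulr DE' eqxx big1; last first.
        by move=> v /negPf vu; rewrite tens_lift_mulr DE' eq_sym vu mul0r.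
      by rewrite addr0 (inj_eq (mulIg _)); over.
    case: eqP => _; first by rewrite phiM.
    by rewrite big1 // => u _; rewrite mulr0.
  move=> a b; rewrite ev2_tl.
  rewrite (@eq_tens_lift _ _ _ _ _ (fun a' b' => \sum_u \sum_v (phi a u * phi b v) *
     (phi a' (m * u^-1)%g * phi b' (n * v^-1)%g))).
    rewrite tens_lift_sum; apply: eq_bigr => u _.
    by rewrite tens_lift_sum; apply: eq_bigr => v _; rewrite tens_lift_mull DE'.
  move=> a' b'; rewrite tens_eval_tens !phiM mulr_suml; apply: eq_bigr => u _.
  by rewrite mulr_sumr; apply: eq_bigr => v _; rewrite mulrACA.
have inA : injective (in_alg L) by apply: fmorph_inj.
have axe1 : e 1 = 1.
  apply: inA; rewrite /= eE phi1 scale1r (bigD1 1%g) //= ffunE eqxx big1 ?addr0 //.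
  by move=> n /negPf n1; rewrite ffunE n1.
have axeM g h : e (g * h) = e g * e h.
  apply: inA; rewrite rmorphM /= !eE.
  under eq_bigr => n _ do rewrite phiM.
  rewrite exchange_big mulr_suml; apply: eq_bigr => m _ /=.
  by rewrite -mulr_sumr [in RHS](reindex_inj (mulIg m^-1%g)).
have algE (c : k) n : phi c%:A n = c%:A * (n == 1%g)%:R.
  by rewrite linearZ phi1 !ffunE mulr_algl.
have axSl h : tens_lift (fun a b => S a * b) (D h) = (e h)%:A.
  apply: phi_inj; apply/ffunP=> n; rewrite phi_tl algE eE.
  rewrite (@eq_tens_lift _ _ _ _ _ (fun a b => \sum_m phi a m^-1%g * phi b (n * m^-1)%g)).
    rewrite tens_lift_sum mulr_suml (reindex_inj invg_inj); apply: eq_bigr => m _ /=.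
    rewrite DE' !invgK; case: (eqVneq n 1%g) => [->|n1]; first by rewrite mul1g eqxx mulr1.
    by rewrite -[X in X == _]mul1g (inj_eq (mulIg _)) eq_sym (negPf n1) mulr0.
  by move=> a b; rewrite phiM; apply: eq_bigr => m _; rewrite SE.
have axSr h : tens_lift (fun a b => a * S b) (D h) = (e h)%:A.
  apply: phi_inj; apply/ffunP=> n; rewrite phi_tl algE eE.
  rewrite (@eq_tens_lift _ _ _ _ _ (fun a b => \sum_m phi a m * phi b (m * n^-1)%g)).
    rewrite tens_lift_sum mulr_suml; apply: eq_bigr => m _ /=.
    rewrite DE'; case: (eqVneq n 1%g) => [->|n1]; first by rewrite invg1 mulg1 eqxx mulr1.
    by rewrite -[X in X == _]mulg1 (inj_eq (mulgI _)) eq_sym eq_invg1 (negPf n1) mulr0.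
  by move=> a b; rewrite phiM; apply: eq_bigr => m _; rewrite SE invMg invgK.
by exists (HopfAlg axA axl axr ax1 axM axe1 axeM axSl axSr), phi.
Qed.

End FromAlgebra.

(** The vanishing of this linear map expresses both the invariance of f and
the condition on its support. *)
Definition fixed_defect (f : grpalg L gT) : {ffun (gal_of {:L} * gT) + gT -> L} :=
  [ffun u => match u with
             | inl p => f (p.2 ^ lam p.1)%g - p.1 (f p.2)
             | inr n => if n \in N then 0 else f n end].

Lemma fixed_defect_linear : linear fixed_defect.
Proof.
move=> c f g; apply/ffunP=> -[[h n]|n]; rewrite !ffunE /=.
  by rewrite linearP /= scalerBr opprD addrACA.
by case: ifP => _; rewrite // scaler0 addr0.
Qed.

HB.instance Definition _ := GRing.isLinear.Build k (grpalg L gT)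
  {ffun (gal_of {:L} * gT) + gT -> L} _ fixed_defect fixed_defect_linear.

Definition fixed_space : {vspace grpalg L gT} := lker (linfun fixed_defect).

Lemma fixed_spaceP f : f \in fixed_space <-> fixed_alg lam N f.
Proof.
rewrite memv_ker lfunE /=; split=> [/eqP/ffunP f0|[fN fe]].
  split=> [n nN|g n]; first by have := f0 (inr n); rewrite !ffunE (negPf nN).
  by apply/eqP; rewrite -subr_eq0; have := f0 (inl (g, n)); rewrite !ffunE => ->.
apply/eqP/ffunP=> -[[g n]|n]; rewrite !ffunE /=; first by rewrite fe subrr.
by case: ifPn => // /fN.
Qed.

Lemma fixed_space1 : 1 \in fixed_space.
Proof.
apply/fixed_spaceP; split=> [n nN|g n]; rewrite !ffunE.
  by case: eqP nN => // ->; rewrite group1.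
by rewrite -(inj_eq (conjg_inj (lam g)) n) conj1g rmorph_nat.
Qed.

Lemma fixed_space_aspace : is_aspace fixed_space.
Proof.
apply/andP; split; first exact: has_algid1 fixed_space1.
apply/prodvP => f h /fixed_spaceP[fN fe] /fixed_spaceP[hN he].
apply/fixed_spaceP; split=> [n nN|g n]; rewrite !ffunE.
  rewrite big1 // => m _; have [Nm|/fN->] := boolP (m \in N); last by rewrite mul0r.
  by rewrite hN ?mulr0 // groupMr ?groupV.
rewrite rmorph_sum (reindex_inj (conjg_inj (lam g))); apply: eq_bigr => m _ /=.
by rewrite rmorphM -conjVg -conjMg fe he.
Qed.

Lemma fixed_hopfAlg_exists :
  exists (HH : hopfAlg k) (psi : {linear HH -> {ffun gT -> L}}),
  presents_fixed_alg psi.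
Proof.
pose A := ASpace fixed_space_aspace.
pose phi_ (h : subvs_of A) : {ffun gT -> L} := vsval h.
have lin_phi : linear phi_ by move=> c g h; rewrite /phi_ linearP.
pose phi : {linear subvs_of A -> {ffun gT -> L}} :=
  HB.pack phi_ (GRing.isLinear.Build _ _ _ _ _ lin_phi).
apply: (@hopfAlg_exists (subvs_of A) phi).
- exact: val_inj.
- move=> f; split=> [[h <-]|]; first by apply/fixed_spaceP; apply: subvsP.
  by move/fixed_spaceP => Af; exists (Subvs Af).
- apply/eqP; have := fixed_space1; rewrite -(algid_eq1 A); exact. 
by move=> g h n; rewrite /phi /= /phi_ /= ffunE.
Qed.

End HopfDescent.

(** * Cosets and embeddings *)

Section Cosets.
Variables (k : fieldType) (L : splittingFieldType k) (K : {subfield L}).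
Hypothesis galL : galois 1 {:L}.
Local Notation G' := 'Gal({:L} / K)%g.
Local Notation c1 := (Defs.coset1 K).
Local Notation lam := (lambda K).

Lemma galKL : galois K {:L}.
Proof. by apply: galoisS galL; rewrite sub1v subvf. Qed.

Lemma GalK_fix g x : g \in G' -> x \in K -> g x = x.
Proof. by move=> G'g Kx; apply: (fixed_gal (subvf K) G'g Kx). Qed.

Lemma GalK_fixed x : (forall g, g \in G' -> g x = x) -> x \in K.
Proof.
by move=> fx; rewrite -(galois_fixedField galKL); apply/fixedFieldP; rewrite ?memvf.
Qed.

Lemma lambdaM : {morph lam : g h / (g * h)%g}.
Proof.
by move=> g h; apply/permP=> X; rewrite permM !permE; apply: val_inj; rewrite /= rcosetM.
Qed.

Lemma val_lambda g X : val (lam g X) = (val X :* g)%g :> {set gal_of {:L}}.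
Proof. by rewrite permE. Qed.

Lemma lambda_c1 (g : gal_of {:L}) : (lam g c1 == c1) = (g \in G').
Proof.
rewrite -val_eqE val_lambda /=; apply/eqP/idP=> [<-|G'g]; first exact: rcoset_refl.
exact: rcoset_id.
Qed.

Lemma lambda_repr (X : gcoset K) g : (g \in val X) = (lam g c1 == X).
Proof.
rewrite -val_eqE val_lambda /=; case: X => X /= /rcosetsP[h _ ->].
by rewrite -rcosetE rcosetE; apply/idP/eqP => [/rcoset_eqP|<-] //; apply: rcoset_refl.
Qed.

Lemma lambda_repr_id (X : gcoset K) : lam (repr (val X)) c1 = X.
Proof.
apply/eqP; rewrite -lambda_repr; case: X => X /= /rcosetsP[h _ ->].
exact: mem_repr_rcoset.
Qed.

(** All representatives of a coset agree on K, since G' fixes K. *)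
Lemma coset_actE g x : x \in K -> coset_act (lam g c1) x = g x.
Proof.
move=> Kx; rewrite /coset_act; set r := repr _.
have : r \in val (lam g c1) by rewrite lambda_repr lambda_repr_id.
rewrite val_lambda => /rcosetP[u G'u ->].
by rewrite gal_mulE (GalK_fix G'u).
Qed.

Lemma coset_act_lambda g X x :
  x \in K -> coset_act (lam g X) x = g (coset_act X x).
Proof.
move=> Kx; rewrite -(lambda_repr_id X) -permM -lambdaM !coset_actE //.
by rewrite gal_mulE.
Qed.

(** Independence of the embeddings of K follows from that of the automorphisms
of L, by evaluation at the traces from L to K. *)
Lemma coset_act_indep (c : gcoset K -> L) :
  (forall x, x \in K -> \sum_X c X * coset_act X x = 0) -> forall X, c X = 0.
Proof.
move=> c0 X; rewrite -(lambda_repr_id X).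
apply: (@gal_independent _ _ _ predT (fun g => c (lam g c1))) => // y _.
pose x := \sum_(u in G') (u : gal_of _) y.
have Kx : x \in K.
  apply: GalK_fixed => g G'g; rewrite rmorph_sum /x [RHS](reindex_acts 'R _ G'g) ?astabsR //=.
  by apply: eq_bigr => u _; rewrite gal_mulE.
rewrite -[RHS](c0 x Kx) (partition_big (fun g => lam g c1) predT) //=.
apply: eq_bigr => Y _; rewrite /coset_act rmorph_sum mulr_sumr /=.
rewrite (reindex_inj (mulIg (repr (val Y)))) /=; apply: eq_big => [u|u uY].
  rewrite -{2}(lambda_repr_id Y) lambdaM permM (inj_eq perm_inj).
  exact: lambda_c1.
by rewrite gal_mulE (eqP uY).
Qed.

Lemma card_gcoset : #|{: gcoset K}| = \dim K.
Proof.
have dK : (\dim {:L} = #|G'| * \dim K)%N.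
  by rewrite -(galois_dim galKL) -dim_sup_field ?subvf.
have d1 : \dim {:L} = #|'Gal({:L} / 1)%g|.
  by rewrite -(galois_dim galL) dimv1 divn1.
rewrite card_sig; have -> : #|rcosets G' 'Gal({:L} / 1)| = \dim K.
  rewrite -[LHS]/(#|'Gal({:L} / 1) : G'|)%g -divgS ?galS ?sub1v // -d1 dK.
  by rewrite mulKn ?cardG_gt0.
by [].
Qed.

End Cosets.

(** * The Hopf Galois structure of a regular subgroup and its correspondence *)

Section RegularSubgroup.
Variables (k : fieldType) (L : splittingFieldType k) (K : {subfield L}).
Hypothesis galL : galois 1 {:L}.
Local Notation c1 := (Defs.coset1 K).
Local Notation lam := (lambda K).
Variable N : {group {perm gcoset K}}.
Hypothesis regN : regular_subgroup N.
Hypothesis nlamN : normalized_by_lambda N.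

Lemma lambda_norm g : lam g \in 'N(N)%g.
Proof. by apply: (subsetP nlamN); apply: imset_f; apply: mem_gal1. Qed.

Lemma regular_inj m n : m \in N -> n \in N -> m c1 = n c1 -> m = n.
Proof.
move=> Nm Nn mn; have [l [_ lE]] := regN c1 (n c1).
by rewrite -(lE m) ?(lE n).
Qed.

Lemma regular_ex X : exists n, (n \in N) && (n c1 == X).
Proof. by have [n [[Nn nX] _]] := regN c1 X; exists n; rewrite Nn nX eqxx. Qed.

(** The coset through which n acts on K in the formula of Greither and Pareigis. *)
Definition to_coset n : gcoset K := (n^-1%g : {perm gcoset K}) c1.
Definition of_coset X : {perm gcoset K} := (xchoose (regular_ex X))^-1%g.

Lemma of_cosetN X : of_coset X \in N.
Proof. by have /andP[+ _] := xchooseP (regular_ex X); rewrite groupV. Qed.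

Lemma of_cosetK X : to_coset (of_coset X) = X.
Proof.
by have /andP[_ /eqP nX] := xchooseP (regular_ex X); rewrite /to_coset invgK.
Qed.

Lemma to_cosetK : {in N, cancel to_coset of_coset}.
Proof.
move=> n Nn; apply: invg_inj; apply: regular_inj; rewrite ?groupV //.
  by rewrite -groupV of_cosetN.
exact: of_cosetK (to_coset n).
Qed.

Lemma card_regular : #|N| = \dim K.
Proof.
rewrite -(card_gcoset K galL) -(card_in_imset (can_in_inj to_cosetK)).
apply: eq_card => X; rewrite [RHS]inE; apply/imsetP; exists (of_coset X).
  exact: of_cosetN.
by rewrite of_cosetK.
Qed.

Lemma to_cosetM m n : to_coset (n * m) = (n^-1)%g (to_coset m).
Proof. by rewrite /to_coset invMg permM. Qed.

Lemma lambda_perm (g : gal_of {:L}) (n : {perm gcoset K}) X :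
  lam g (n X) = (n ^ lam g)%g (lam g X).
Proof. by rewrite permJ. Qed.

Lemma lambda_to_coset g n : (g \in 'Gal({:L} / K))%g ->
  lam g (to_coset n) = to_coset (n ^ lam g)%g.
Proof.
rewrite -lambda_c1 => /eqP gc1.
by rewrite /to_coset lambda_perm gc1 conjVg.
Qed.

Section Action.
Variables (H : hopfAlg k) (phi : {linear H -> {ffun {perm gcoset K} -> L}}).
Hypothesis phi_inj : injective phi.
Hypothesis phi_im : forall f, (exists h, phi h = f) <-> fixed_alg lam N f.
Hypothesis phi1 : phi 1 = [ffun n => (n == 1%g)%:R].
Hypothesis phiM : forall g h n,
  phi (g * h) n = \sum_m phi g m * phi h (n * m^-1)%g.
Hypothesis phiD : forall h m n, tens_eval phi phi (comult h) (m, n)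
  = if m == n then phi h n else 0.
Hypothesis phie : forall h, (counit h)%:A = \sum_n phi h n.
Hypothesis phiS : forall h n, phi (antipode h) n = phi h n^-1%g.

Let phiE h (g : gal_of {:L}) n : phi h (n ^ lam g)%g = g (phi h n) :=
  phi_eqv phi_im h g n.
Let phi0 := phi_out phi_im.

Lemma phi_sum_group h (c : {perm gcoset K} -> L) :
  \sum_n phi h n * c n = \sum_(n in N) phi h n * c n.
Proof.
rewrite [LHS](bigID [in N]) /= [X in _ + X]big1 ?addr0 // => n nN.
by rewrite phi0 ?mul0r.
Qed.

(** The sum may run over all permutations, as phi h vanishes outside N. *)
Definition descent_act h (x : L) : L :=
  \sum_n phi h n * coset_act (to_coset n) x.

(** An element g of G' fixes the base coset, so it moves the coset of n to the
coset of the conjugate of n by lambda g: it permutes the terms of the sum. *)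
Lemma descent_act_mem h x : x \in K -> descent_act h x \in K.
Proof.
move=> Kx; apply: (GalK_fixed galL) => g G'g; rewrite rmorph_sum.
rewrite [RHS](reindex_inj (conjg_inj (lam g))); apply: eq_bigr => n _ /=.
by rewrite rmorphM phiE /= -(coset_act_lambda g _ Kx) lambda_to_coset.
Qed.

(** Let r represent the coset of m. Applying r to the sum that defines h . x
conjugates its indices by lambda r, and reindexing by this conjugation gives the
cosets of the products. *)
Lemma descent_actM g h x : x \in K ->
  descent_act (g * h) x = descent_act g (descent_act h x).
Proof.
move=> Kx; rewrite /descent_act.
under eq_bigr => n _ do rewrite phiM mulr_suml.
rewrite exchange_big; apply: eq_bigr => m _ /=.
rewrite (reindex_inj (mulIg m)) /=.
under eq_bigr => n _ do rewrite mulgK -mulrA.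
rewrite -mulr_sumr; congr (_ * _).
set r := repr (val (to_coset m)).
have rE : lam r c1 = to_coset m by apply: lambda_repr_id.
rewrite [RHS]linear_sum (reindex_inj (conjg_inj (lam r))).
apply: eq_bigr => n _ /=; rewrite phiE.
by rewrite rmorphM /= -(coset_act_lambda r _ Kx) lambda_perm rE to_cosetM conjVg.
Qed.

Lemma descent_act_linear h : linear (descent_act h).
Proof.
move=> c x y; rewrite /descent_act scaler_sumr -big_split; apply: eq_bigr => n _.
by rewrite /coset_act linearP mulrDr scalerAr.
Qed.

Lemma descent_act_linearl c g h x :
  descent_act (c *: g + h) x = c *: descent_act g x + descent_act h x.
Proof.
rewrite /descent_act scaler_sumr -big_split; apply: eq_bigr => n _.
by rewrite linearP !ffunE mulrDl scalerAl.
Qed.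

(** An element of the kernel of K (x) H -> End(K) yields a vanishing
L-combination of embeddings of K, so its coefficients vanish by the independence
of the embeddings and then by that of the invariants. The dimension of H is at
least #|N| = [K : k], so an injective map is bijective. *)
Lemma hopfGalois_of_descent : exists S : hopfGalois H (subvs_of K),
  forall h x, vsval (S h x) = descent_act h (vsval x).
Proof.
pose a h (x : subvs_of K) : subvs_of K := vsproj K (descent_act h (vsval x)).
have aE h x : vsval (a h x) = descent_act h (vsval x).
  by rewrite vsprojK ?descent_act_mem ?subvsP.
have lin_a h : linear (a h).
  by move=> c x y; apply: val_inj; rewrite /= !aE linearP descent_act_linear.
pose ah h : {linear subvs_of K -> subvs_of K} :=
  HB.pack (a h) (GRing.isLinear.Build _ _ _ _ _ (lin_a h)).
pose A h : 'End(subvs_of K) := linfun (ah h).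
have lin_A : linear A.
  move=> c g h; apply/lfunP => x; rewrite add_lfunE scale_lfunE !lfunE /=.
  by apply: val_inj; rewrite /= !aE descent_act_linearl.
pose AH : {linear H -> 'End(subvs_of K)} :=
  HB.pack A (GRing.isLinear.Build _ _ _ _ _ lin_A).
have AHE h x : vsval (AH h x) = descent_act h (vsval x) by rewrite lfunE /= aE.
have ax1 x : AH 1 x = x.
  apply: val_inj; rewrite /= AHE /descent_act phi1 (bigD1 1%g) //= ffunE eqxx mul1r.
  rewrite big1 ?addr0; last by move=> n /negPf n1; rewrite ffunE n1 mul0r.
  have -> : to_coset 1%g = lam 1%g c1.
    rewrite /to_coset invg1 perm1; apply/esym/eqP.
    by rewrite lambda_c1 group1.
  by rewrite coset_actE ?subvsP // gal_id.
have axM g h x : AH (g * h) x = AH g (AH h x).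
  by apply: val_inj; rewrite /= !AHE descent_actM ?subvsP.
have axu h : AH h 1 = (counit h)%:A.
  apply: val_inj; rewrite /= AHE /= !algid1 ?mem1v //.
  rewrite phie /descent_act; apply: eq_bigr => n _.
  by rewrite /coset_act rmorph1 mulr1.
have axmul h x y :
    AH h (x * y) = tens_lift (fun a b => AH a x * AH b y) (comult h).
  apply: val_inj; rewrite /= AHE /= linear_tens_lift /=.
  rewrite (@eq_tens_lift _ _ _ _ _ (fun a b => \sum_m \sum_n (phi a m * phi b n) *
      (coset_act (to_coset m) (vsval x) * coset_act (to_coset n) (vsval y)))).
    rewrite tens_lift_sum; apply: eq_bigr => m _; rewrite tens_lift_sum.
    have E n : tens_lift (fun a b => phi a m * phi b n) (comult h)
        = if m == n then phi h n else 0 by rewrite -phiD ffunE.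
    rewrite (bigD1 m) //= tens_lift_mulr E eqxx big1 ?addr0.
      by rewrite /coset_act rmorphM.
    by move=> n /negPf nm; rewrite tens_lift_mulr E eq_sym nm mul0r.
  move=> g h'; rewrite !AHE /descent_act mulr_suml; apply: eq_bigr => m _.
  by rewrite mulr_sumr; apply: eq_bigr => n _; rewrite mulrACA.
have cocomm : cocommutative H.
  move=> h; apply: (tens_eval2_inj galL (@lambdaM _ _ K) phi_inj phi_im).
  apply/ffunP=> -[m n]; rewrite phiD linear_tens_lift /tens_lift sum_ffunE.
  transitivity (tens_eval phi phi (comult h) (n, m)).
    rewrite [RHS]ffunE; apply: eq_bigr => i _; rewrite sum_ffunE.
    by apply: eq_bigr => j _; rewrite ffunE tens_eval_tens mulrC.
  by rewrite phiD eq_sym; case: eqP => [->|].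
have gal_bij : bijective (hopf_galois_map AH).
  pose hg : {linear tens_type (subvs_of K) H -> 'End(subvs_of K)} :=
    tens_lift (fun (s : subvs_of K) (h : H) => (amull s \o AH h)%VF).
  have ker0 : lker (linfun hg) == 0%VS.
    apply/lker0P => t u; rewrite !lfunE => /eqP; rewrite -subr_eq0 -linearB => /eqP.
    move=> tu0; apply/eqP; rewrite -subr_eq0; apply/eqP.
    move: (t - u) tu0 => {t u} t t0.
    (* t is the tensor of the l_j and the j-th basis vectors of H. *)
    pose l j : L := \sum_i t i j *: vsval (vbasis {:subvs_of K})`_i.
    have sum0 x : x \in K -> \sum_n (\sum_j l j * phi (vbasis {:H})`_j n) *
        coset_act (to_coset n) x = 0.
      move=> Kx; have e0 : vsval (hg t (Subvs Kx)) = 0 by rewrite t0 lfunE.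
      rewrite -[RHS]e0 /hg /= /tens_lift sum_lfunE linear_sum /=.
      under eq_bigr => n _ do rewrite mulr_suml.
      rewrite exchange_big /=.
      under [RHS]eq_bigr => i _ do rewrite sum_lfunE linear_sum /=.
      rewrite [RHS]exchange_big; apply: eq_bigr => j _ /=.
      transitivity (l j * descent_act (vbasis {:H})`_j x).
        by rewrite mulr_sumr; apply: eq_bigr => n _; rewrite mulrA.
      rewrite mulr_suml; apply: eq_bigr => i _.
      rewrite scale_lfunE comp_lfunE /= lfunE /= -[vsval (A _ _)]/(vsval (AH _ _)).
      by rewrite AHE -scalerAl.
    have l0 j : l j = 0.
      move: j; apply: (fixed_alg_indep galL (@lambdaM _ _ K) phi_inj phi_im) => n.
      have [Nn|nN] := boolP (n \in N); last first.
        by rewrite big1 // => j _; rewrite phi0 ?mulr0.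
      rewrite -[n](to_cosetK Nn); move: (to_coset n).
      apply: (coset_act_indep galL) => x /sum0 s0; rewrite -[RHS]s0.
      rewrite [RHS](bigID [in N]) /= [X in _ + X]big1 ?addr0; last first.
        by move=> m nNm; rewrite big1 ?mul0r // => j _; rewrite phi0 ?mulr0.
      rewrite [RHS](reindex_onto of_coset to_coset) => [|m]; last exact: to_cosetK.
      by apply: eq_big => [X|X _]; rewrite ?of_cosetN of_cosetK ?eqxx.
    have /freeP free := basis_free (vbasisP {:subvs_of K}).
    apply/matrixP=> i j; rewrite !mxE; move: i.
    apply: free; apply: val_inj; rewrite /= linear_sum -[RHS](l0 j).
    by apply: eq_bigr => i _; rewrite linearZ.
  have lim : limg (linfun hg) = fullv.
    apply/eqP; rewrite eqEdim subvf limg_dim_eq ?(eqP ker0) ?capv0 //=.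
    have dS : \dim {:subvs_of K} = \dim K by rewrite dimvf.
    have dE : \dim {:'End(subvs_of K)} = (\dim K * \dim K)%N by rewrite dimvf.
    rewrite dE [X in (_ <= X)%N]dimvf dim_matrix dS leq_pmul2l ?adim_gt0 //.
    rewrite -card_regular.
    exact: (card_le_dim_fixed_alg (@lambdaM _ _ K) lambda_norm phi_im).
  exists (linfun hg)^-1%VF => u.
    by rewrite -[hopf_galois_map _ _](lfunE hg) lker0_lfunK.
  by rewrite -[hopf_galois_map _ _](lfunE hg) limg_lfunVK ?lim ?memvf.
by exists (HopfGalois ax1 axM axu axmul cocomm gal_bij).
Qed.

Lemma given_by_descent (S : hopfGalois H (subvs_of K)) :
  (forall h x, vsval (S h x) = descent_act h (vsval x)) -> given_by S N.
Proof.
move=> SE; split=> //; exists phi; split=> //.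
  move=> f; split=> [/phi_im[fN fe]|[fN fe]]; first by split=> // g _ n; apply: fe.
  by apply/phi_im; split=> // g n; apply: fe; apply: mem_gal1.
split=> //.
- move=> g h; apply/ffunP=> n; rewrite phiM ffunE.
  rewrite (phi_sum_group g (fun m => phi h (n * m^-1)%g)).
  apply: eq_bigr => m Nm; rewrite -mulr_sumr; congr (_ * _).
  have lE l : (n == l * m)%g = (l == n * m^-1)%g.
    by rewrite eq_sym -(inj_eq (mulIg m^-1%g)) mulgK.
  have [Nnm|nNnm] := boolP (n * m^-1 \in N)%g.
    rewrite (big_pred1 (n * m^-1)%g) // => l; rewrite lE.
    by rewrite /= andbC; case: eqP => [->|_].
  rewrite phi0 // big_pred0 // => l; rewrite lE.
  by rewrite andbC; case: eqP => [->|_] //; apply: negPf.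
- by move=> h m n; rewrite -phiD ffunE.
- move=> h; rewrite phie; under [RHS]eq_bigr => n _ do rewrite -[phi h n]mulr1.
  by rewrite (phi_sum_group h (fun=> 1)); apply: eq_bigr => n _; rewrite mulr1.
split=> [h|h x]; first by apply/ffunP=> n; rewrite ffunE phiS.
by rewrite SE /descent_act (phi_sum_group h (fun n => coset_act (to_coset n) _)).
Qed.

Section Correspondence.
Variable S : hopfGalois H (subvs_of K).
Hypothesis SE : forall h x, vsval (S h x) = descent_act h (vsval x).

Lemma supp_in_subhopf (N' : {group {perm gcoset K}}) :
    N' \subset N -> (forall g, lam g \in 'N(N')%g) ->
  is_subhopf (supp_in phi N').
Proof.
move=> sN'N nN'; split.
- apply/supp_inP => n nN'n; rewrite phi1 ffunE.
  by case: eqP nN'n => // ->; rewrite group1.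
- move=> a b /supp_inP a0 /supp_inP b0; apply/supp_inP => n nN'n.
  rewrite phiM big1 // => m _; have [N'm|/a0->] := boolP (m \in N'); last first.
    by rewrite mul0r.
  by rewrite b0 ?mulr0 // groupMr ?groupV.
- move=> a /supp_inP a0.
  have [||||t tA tE] := @tens_eval2_surj _ _ galL _ _ (@lambdaM _ _ K) _ lambda_norm
      _ _ phi_im N' (tens_eval phi phi (comult a)).
  + by [].
  + by move=> g n; rewrite memJ_norm.
  + move=> g [m n] /=; rewrite !phiD (inj_eq (conjg_inj _)).
    by case: (m == n); rewrite ?raddf0 ?phiE.
  + move=> [m n]; rewrite phiD /=; have [->|_] := eqVneq m n; last by rewrite eqxx.
    by rewrite andbb; apply: contraNT => /a0->.
  suff -> : comult a = t by [].
  by apply: (tens_eval2_inj galL (@lambdaM _ _ K) phi_inj phi_im); apply/ffunP=> p.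
move=> a /supp_inP a0; apply/supp_inP => n nN'n.
by rewrite phiS a0 ?groupV.
Qed.

(** If a(n) is nonzero for some a in A, then the comultiplication of a, with
its second variable evaluated at n, shows that the delta function at n lies in
the L-span of A. Hence this span is L[N'] for the union N' of the supports, N' is
closed under products, and A = L[N']^G by [trace_descent]. *)
Lemma subhopf_supp_in (A : {vspace H}) : is_subhopf A ->
  exists N' : {group {perm gcoset K}},
    [/\ N' \subset N, forall g, lam g \in 'N(N')%g & A = supp_in phi N'].
Proof.
move=> [A1 AM AD _].
pose b (i : 'I_(\dim A)) := (vbasis A)`_i.
have Ab (i : 'I_(\dim A)) : b i \in A by rewrite vbasis_mem ?memt_nth.
pose T := [set n | [exists i : 'I_(\dim A), phi (b i) n != 0]].
have TP n : reflect (exists2 a, a \in A & phi a n != 0) (n \in T).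
  rewrite inE; apply: (iffP existsP) => [[i nz]|[a Aa nz]]; first by exists (b i).
  apply/existsP; apply: contraR nz; rewrite negb_exists => /forallP b0.
  rewrite (coord_vbasis Aa) linear_sum sum_ffunE big1 // => i _.
  by rewrite linearZ ffunE (eqP (negPn (b0 i))) scaler0.
have delta n : n \in T -> exists c : 'I_(\dim A) -> L,
    forall m, \sum_i c i * phi (b i) m = (m == n)%:R.
  case/TP => a Aa nz; have [s sE] := tensvP (AD a Aa).
  exists (fun i => (phi a n)^-1 * \sum_j s i j *: phi (b j) n) => m.
  transitivity ((phi a n)^-1 * tens_eval phi phi (comult a) (m, n)).
    rewrite sE linear_sum sum_ffunE mulr_sumr; apply: eq_bigr => i _.
    rewrite linear_sum sum_ffunE -mulrA mulr_suml; congr (_ * _).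
    apply: eq_bigr => j _; rewrite linearZ ffunE tens_eval_tens -scalerAl.
    by rewrite mulrC.
  by rewrite phiD; have [_|_] := eqVneq m n; rewrite ?mulVf ?mulr0.
have T1 : 1%g \in T by apply/TP; exists 1; rewrite // phi1 ffunE eqxx oner_neq0.
have gT : group_set T.
  apply/group_setP; split=> // m n /delta[c cE] /delta[c' cE'].
  have : \sum_i \sum_j c i * c' j * phi (b j * b i) (m * n)%g = 1.
    transitivity (\sum_i \sum_j \sum_l
        (c i * phi (b i) (m * n * l^-1)%g) * (c' j * phi (b j) l)).
      apply: eq_bigr => i _; apply: eq_bigr => j _; rewrite phiM mulr_sumr.
      by apply: eq_bigr => l _; rewrite [phi (b j) l * _]mulrC mulrACA.
    under eq_bigr => i _ do rewrite exchange_big /=.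
    rewrite exchange_big /=; under eq_bigr => l _.
      under eq_bigr => i _ do rewrite -mulr_sumr cE'.
      rewrite -mulr_suml cE; over.
    rewrite (bigD1 n) //= eqxx mulr1 mulgK eqxx big1 ?addr0 // => l /negPf->.
    by rewrite mulr0.
  move=> sum1; apply: contra_eqT sum1 => nT; rewrite big1; first by rewrite eq_sym oner_eq0.
  move=> i _; rewrite big1 // => j _; apply/eqP; apply: contraNT nT => nz.
  apply/TP; exists (b j * b i); first by apply: AM.
  by apply: contraNneq nz => ->; rewrite mulr0.
have sTN : T \subset N.
  by apply/subsetP => n /TP[a _]; apply: contraR => /phi0->.
exists (Group gT); split=> //.
  move=> g; rewrite /= inE; apply/subsetP => _ /imsetP[n /TP[a Aa nz] ->].
  by apply/TP; exists a; rewrite // phiE fmorph_eq0.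
apply/vspaceP => h; apply/idP/idP => [Ah|/supp_inP h0].
  apply/supp_inP => n; apply: contraNeq => nz; apply/TP; by exists h.
have /fin_all_exists[c cE] : forall n, exists c : 'I_(\dim A) -> L,
    n \in T -> forall m, \sum_i c i * phi (b i) m = (m == n)%:R.
  move=> n; have [/delta[c cE]|_] := boolP (n \in T); first by exists c.
  by exists (fun=> 0).
have hE m : phi h m = \sum_i (\sum_n phi h n * c n i) * phi (b i) m.
  transitivity (\sum_n phi h n * (m == n)%:R).
    rewrite (bigD1 m) //= eqxx mulr1 big1 ?addr0 // => n.
    by rewrite eq_sym => /negPf->; rewrite mulr0.
  under [RHS]eq_bigr => i _ do rewrite mulr_suml.
  rewrite exchange_big; apply: eq_bigr => n _ /=.
  have [Tn|Tn] := boolP (n \in T); last first.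
    by rewrite h0 // mul0r big1 // => i _; rewrite !mul0r.
  by rewrite -(cE n Tn) mulr_sumr; apply: eq_bigr => i _; rewrite mulrA.
have [y y_tr1] := tr_surj galL.
suff -> : h = \sum_i trk galL (y * \sum_n phi h n * c n i) *: b i.
  by apply: memv_suml => i _; apply: memvZ.
apply: phi_inj; apply/ffunP=> m; rewrite linear_sum sum_ffunE -[LHS]mul1r -y_tr1.
rewrite (trace_descent galL (conj_lamK (@lambdaM _ _ K)) (phiE h)
          (fun i => phiE (b i)) hE).
by apply: eq_bigr => i _; rewrite linearZ ffunE.
Qed.

(** For N' normalized by lambda(G) this is the group whose fixed field belongs
to L[N']^G. *)
Definition coset_stab (N' : {set {perm gcoset K}}) : {set gal_of {:L}} :=
  [set g | [exists n in N', n c1 == lam g c1]].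

Lemma coset_stabP (N' : {set {perm gcoset K}}) g :
  reflect (exists2 n, n \in N' & n c1 = lam g c1) (g \in coset_stab N').
Proof.
rewrite inE; apply: (iffP existsP) => [[n /andP[N'n /eqP]]|[n N'n /eqP]]; first by exists n.
by exists n; apply/andP.
Qed.

Lemma coset_stab_group_set (N' : {group {perm gcoset K}}) :
  (forall g, lam g \in 'N(N')%g) -> group_set (coset_stab N').
Proof.
move=> nN'; apply/group_setP; split=> [|g h].
  by apply/coset_stabP; exists 1%g; rewrite ?group1 // (lam1 (@lambdaM _ _ K)).
move=> /coset_stabP[m N'm mE] /coset_stabP[n N'n nE]; apply/coset_stabP.
exists (n * m ^ lam h)%g; first by rewrite groupM ?memJ_norm.
by rewrite lambdaM [LHS]permM [RHS]permM nE -lambda_perm mE.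
Qed.

(** As the delta functions on N' are L-combinations of invariants supported on
N', the element x is fixed by L[N']^G exactly when each n in N' acts trivially on it. *)
Lemma hopf_fixedP (N' : {group {perm gcoset K}}) (x : subvs_of K) :
    N' \subset N -> (forall g, lam g \in 'N(N')%g) ->
  vsval x \in fixedField (coset_stab N') <->
  (forall h, h \in supp_in phi N' -> S h x = counit h *: x).
Proof.
move=> sN'N nN'; have Kx := subvsP x.
have fixE : (forall n, n \in N' -> coset_act (to_coset n) (vsval x) = vsval x) <->
    vsval x \in fixedField (coset_stab N').
  split=> [fx|/mem_fixedFieldP[_ fx] n N'n].
    apply/fixedFieldP; first exact: memvf.
    move=> g /coset_stabP[n N'n nE]; rewrite -(coset_actE g Kx) -nE.
    by rewrite -[n]invgK; apply: fx; rewrite groupV.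
  set X := to_coset n; rewrite -(lambda_repr_id X) (coset_actE _ Kx); apply: fx.
  apply/coset_stabP; exists n^-1%g; rewrite ?groupV // lambda_repr_id //.
split=> [/fixE fx h /supp_inP h0|fx].
  apply: val_inj; rewrite /= SE /descent_act.
  transitivity (\sum_n phi h n * vsval x).
    apply: eq_bigr => n _; have [N'n|/h0->] := boolP (n \in N'); first by rewrite fx.
    by rewrite !mul0r.
  by rewrite -mulr_suml -phie mulr_algl.
apply/fixE => n N'n; have [w [c wc]] := orbit_sum_dual (@lambdaM _ _ K).
apply/eqP; rewrite -subr_eq0; apply/eqP.
transitivity (\sum_m (n == m)%:R * (coset_act (to_coset m) (vsval x) - vsval x)).
  rewrite (bigD1 n) //= eqxx mul1r big1 ?addr0 // => m.
  by rewrite eq_sym => /negPf->; rewrite mul0r.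
under eq_bigr => m _ do rewrite -wc mulr_suml.
rewrite exchange_big big1 //= => i _.
have [|h hA hE] := orbit_sum_supp_in (@lambdaM _ _ K) lambda_norm phi_im
  sN'N _ (w i) N'n; first by move=> g m; rewrite memJ_norm.
under eq_bigr => m _ do rewrite -mulrA mulrBr -hE.
rewrite -mulr_sumr sumrB -mulr_suml -phie mulr_algl -[X in X - _](SE h x).
by rewrite fx // subrr mulr0.
Qed.

Lemma galK_sub_coset_stab (N' : {group {perm gcoset K}}) :
  'Gal({:L} / K)%g \subset coset_stab N'.
Proof.
apply/subsetP => g G'g; apply/coset_stabP; exists 1%g; rewrite // perm1.
by apply/esym/eqP; rewrite lambda_c1.
Qed.

(** An element of a regular group is determined by the image of one point. *)
Lemma coset_stab_inj (N1 N2 : {group {perm gcoset K}}) :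
  N1 \subset N -> N2 \subset N -> coset_stab N1 = coset_stab N2 -> N1 = N2.
Proof.
suff sub (P Q : {group {perm gcoset K}}) : P \subset N -> Q \subset N ->
    coset_stab P = coset_stab Q -> P \subset Q.
  by move=> s1 s2 e; apply/val_inj/eqP; rewrite eqEsubset; apply/andP; split; apply: sub.
move=> sP sQ e; apply/subsetP => n Pn.
have : repr (val (n c1)) \in coset_stab P.
  by apply/coset_stabP; exists n; rewrite ?lambda_repr_id.
rewrite e => /coset_stabP[m Qm]; rewrite lambda_repr_id => mn.
by rewrite -(regular_inj (subsetP sQ m Qm) (subsetP sP n Pn) mn).
Qed.

Lemma subfield_preim (F : {subfield L}) : exists E : {subfield subvs_of K},
  forall x, (x \in E) = (vsval x \in F).
Proof.
pose E := (linfun (vsval : subvs_of K -> L) @^-1: F)%VS.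
have EE x : (x \in E) = (vsval x \in F) by rewrite -memv_preim lfunE.
have aE : is_aspace E.
  apply/andP; split; first by apply: has_algid1; rewrite EE /= algid1 ?mem1v.
  by apply/prodvP => x y; rewrite !EE => Fx Fy; rewrite rpredM.
by exists (ASpace aE).
Qed.

Lemma subfield_img (E : {subfield subvs_of K}) : exists2 F : {subfield L},
  {subset F <= K} & forall x, (x \in E) = (vsval x \in F).
Proof.
pose F := (linfun (vsval : subvs_of K -> L) @: E)%VS.
have EE x : (x \in E) = (vsval x \in F).
  apply/idP/memv_imgP => [Ex|[y Ey]]; first by exists x; rewrite ?lfunE.
  by rewrite lfunE /= => /val_inj->.
have vK1 : vsval (1 : subvs_of K) = 1 by rewrite /= algid1 ?mem1v.
have aF : is_aspace F.
  apply/andP; split.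
    by apply: has_algid1; rewrite -[1]vK1 -EE mem1v.
  apply/prodvP => _ _ /memv_imgP[x Ex ->] /memv_imgP[y Ey ->].
  by rewrite !lfunE -rmorphM -EE rpredM.
by exists (ASpace aF) => // _ /memv_imgP[x _ ->]; rewrite lfunE; apply: subvsP.
Qed.

(** By [subhopf_supp_in] and [hopf_fixedP] the correspondence maps N' to the
fixed field of [coset_stab N'], and distinct N' have distinct fixed fields by the
Galois correspondence of L/k. *)
Lemma galois_corr_of_stable :
    (forall U : {group gal_of {:L}}, 'Gal({:L} / K)%g \subset U ->
       exists N' : {group {perm gcoset K}},
         [/\ N' \subset N, forall g, lam g \in 'N(N')%g & coset_stab N' = U]) ->
  galois_corr_bijective S.
Proof.
move=> exN'; split=> [A /subhopf_supp_in[N' [sN'N nN' ->]]|F].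
  have [F FE] := subfield_preim (fixedField_aspace (coset_stab N')).
  by exists F => x; rewrite FE; apply: hopf_fixedP.
have [FL sFLK0 FLE] := subfield_img F.
have sFLK : ('Gal({:L} / K) \subset 'Gal({:L} / FL))%g.
  apply: galS; apply/subvP => y FLy; exact: sFLK0.
have galF : fixedField ('Gal({:L} / FL))%g = FL.
  by apply/galois_fixedField; apply: galoisS galL; rewrite sub1v subvf.
have [N' [sN'N nN' stN']] := exN' _ sFLK.
exists (supp_in phi N'); split.
  split; first exact: supp_in_subhopf.
  by move=> x; rewrite FLE -galF -stN'; apply: hopf_fixedP.
move=> A [/subhopf_supp_in[N2 [sN2 nN2 ->]] fixA].
suff -> : N' = N2 by []; apply: coset_stab_inj => //.
have -> : coset_stab N' = 'Gal({:L} / fixedField (coset_stab N'))%g.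
  by rewrite (gal_fixedField (Group (coset_stab_group_set nN'))).
have -> : coset_stab N2 = 'Gal({:L} / fixedField (coset_stab N2))%g.
  by rewrite (gal_fixedField (Group (coset_stab_group_set nN2))).
congr (galoisG _ _).
have inK (M : {group {perm gcoset K}}) y : y \in fixedField (coset_stab M) -> y \in K.
  move=> /mem_fixedFieldP[_ fy]; apply: (GalK_fixed galL) => g G'g; apply: fy.
  exact: (subsetP (galK_sub_coset_stab M)).
suff e (x : subvs_of K) :
    (vsval x \in fixedField (coset_stab N')) = (vsval x \in fixedField (coset_stab N2)).
  apply/vspaceP => y; apply/idP/idP => fy; have Ky := inK _ _ fy.
    by rewrite -[y]/(vsval (Subvs Ky)) -e.
  by rewrite -[y]/(vsval (Subvs Ky)) e.
rewrite stN' galF -FLE; apply/idP/idP => [Fx|].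
  by apply/(hopf_fixedP _ sN2 nN2)/fixA.
by move/(hopf_fixedP _ sN2 nN2)/fixA.
Qed.

End Correspondence.

End Action.

Theorem hopfGalois_of_regular :
  exists (H : hopfAlg k) (S : hopfGalois H (subvs_of K)),
    given_by S N /\
    ((forall U : {group gal_of {:L}}, 'Gal({:L} / K)%g \subset U ->
        exists N' : {group {perm gcoset K}},
          [/\ N' \subset N, forall g, lam g \in 'N(N')%g & coset_stab N' = U]) ->
     galois_corr_bijective S).
Proof.
have [H [phi [inj im [p1 pM pD pe pS]]]] :=
  fixed_hopfAlg_exists galL (@lambdaM _ _ K) lambda_norm.
have [S SE] := hopfGalois_of_descent inj im p1 pM pD pe.
exists H, S; split; first exact: given_by_descent SE.
exact: galois_corr_of_stable SE.
Qed.

End RegularSubgroup.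

(** * Regular subgroups for a Galois group of affine maps *)

Section AffineCoordinates.
Variables (k : fieldType) (L : splittingFieldType k) (K : {subfield L}).
Hypothesis galL : galois 1 {:L}.
Local Notation c1 := (Defs.coset1 K).
Local Notation lam := (lambda K).
Local Notation G' := ('Gal({:L} / K))%g.
Variables (p d m : nat).
Hypotheses (pr_p : prime p) (m_gt1 : (1 < m)%N) (d_gt1 : (1 < d)%N).
Hypothesis (pmd : (p - 1 = m * d)%N).
Variable F : finFieldType.
Hypotheses (card_F : #|F| = p) (natF : forall x : F, exists n, x = n%:R).
Hypothesis pF : p%:R = 0 :> F.
Variables (beta gam : gal_of {:L} -> F).
Hypothesis gamM : forall g h, gam (g * h)%g = gam g * gam h.
Hypothesis betaM : forall g h, beta (g * h)%g = beta h + beta g * gam h.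
Hypothesis bg_inj : forall g h, beta g = beta h -> gam g = gam h -> g = h.
Hypothesis gamX : forall g, gam g ^+ (m * d) = 1.
Hypothesis bg_surj : forall b c, c ^+ (m * d) = 1 -> exists g, beta g = b /\ gam g = c.
Hypothesis card_G' : #|G'| = m.
Hypothesis card_coset : #|{: gcoset K}| = (p * d)%N.

Lemma md_gt0 : (0 < m * d)%N.
Proof. by rewrite muln_gt0 !(ltn_trans (ltn0Sn 0)). Qed.

Lemma gam_neq0 g : gam g != 0.
Proof.
apply: contra_eq_neq (gamX g) => ->.
by rewrite expr0n eqn0Ngt md_gt0 eq_sym oner_eq0.
Qed.

Lemma gam1 : gam 1%g = 1.
Proof. by apply: (mulfI (gam_neq0 1%g)); rewrite -gamM mulr1 mulg1. Qed.

Lemma beta1 : beta 1%g = 0.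
Proof. by apply: (addrI (beta 1%g)); rewrite addr0 -{3}[1%g]mulg1 betaM gam1 mulr1. Qed.

Lemma gamV g : gam g^-1%g = (gam g)^-1.
Proof. by apply: (mulfI (gam_neq0 g)); rewrite -gamM mulgV gam1 divff ?gam_neq0. Qed.

Lemma gamXn g n : gam (g ^+ n)%g = gam g ^+ n.
Proof. by elim: n => [|n IHn]; rewrite ?gam1 // expgS exprS gamM IHn. Qed.

(** The action of the matrix (1 b; 0 c) on row vectors (1 x), a right action. *)
Definition aff g x := beta g + gam g * x.

Lemma affM g h x : aff (g * h)%g x = aff h (aff g x).
Proof. by rewrite /aff betaM gamM; ring. Qed.

Lemma aff1 x : aff 1%g x = x.
Proof. by rewrite /aff beta1 gam1 mul1r add0r. Qed.

Lemma aff_inj g h x : gam g = gam h -> aff g x = aff h x -> g = h.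
Proof. by move=> e; rewrite /aff e => /addIr bE; apply: bg_inj. Qed.

Lemma aff_fixV g x : aff g x = x -> aff g^-1%g x = x.
Proof. by move=> gx; rewrite -{1}gx -affM mulgV aff1. Qed.

Lemma beta_expg t n : gam t = 1 -> beta (t ^+ n)%g = n%:R * beta t.
Proof.
move=> t1; elim: n => [|n IHn]; first by rewrite beta1 mul0r.
by rewrite expgSr betaM t1 mulr1 IHn -addn1 natrD mulrDl mul1r addrC.
Qed.

(** The translations are the multiples of any nonzero one, as F is a prime field. *)
Lemma transl_expg t u : gam t = 1 -> t != 1%g -> gam u = 1 ->
  exists n, u = (t ^+ n)%g.
Proof.
move=> t1 nt u1; have bt : beta t != 0.
  by apply: contraNneq nt => bt0; apply/eqP/bg_inj; rewrite ?bt0 ?t1 ?beta1 ?gam1.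
have [n nE] := natF (beta u / beta t).
exists n; apply: bg_inj; last by rewrite gamXn t1 expr1n.
by rewrite beta_expg // -nE divfK.
Qed.

(** Since gam embeds U in a commutative group, U is commutative; so it preserves
the unique fixed point of g0. *)
Lemma fix_common (U : {group gal_of {:L}}) g0 x :
    (forall g, g \in U -> gam g = 1 -> g = 1%g) ->
    g0 \in U -> gam g0 != 1 -> aff g0 x = x ->
  forall g, g \in U -> aff g x = x.
Proof.
move=> injU Ug0 g01 fx g Ug.
have cgg0 : (g * g0 = g0 * g)%g.
  apply/eqP; rewrite eq_mulVg1; apply/eqP/injU; first by rewrite !groupM ?groupV ?groupM.
  rewrite !(gamM, gamV) invfM; have := gam_neq0 g; have := gam_neq0 g0.
  by move=> *; field; rewrite !gam_neq0.
have e : aff g0 (aff g x) = aff g x by rewrite -affM cgg0 affM fx.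
have : (gam g0 - 1) * (aff g x - x) = 0.
  have e' : aff g0 (aff g x) - aff g0 x = aff g x - x by rewrite e fx.
  move: (aff g x) e' => y e'.
  have -> : (gam g0 - 1) * (y - x) = (aff g0 y - aff g0 x) - (y - x).
    by rewrite /aff; ring.
  by rewrite e' subrr.
move/eqP; rewrite mulf_eq0 subr_eq0 (negPf g01) subr_eq0.
by move/eqP.
Qed.

(** A translation has order dividing p, and the order m of G' is less than p. *)
Lemma gam_inj_G' g : g \in G' -> gam g = 1 -> g = 1%g.
Proof.
move=> G'g g1; 
have dp : (#[g]%g %| p)%N.
  rewrite order_dvdn; apply/eqP/bg_inj; last by rewrite gamXn g1 expr1n gam1.
  by rewrite beta_expg // beta1 pF mul0r.
have dm : (#[g]%g %| m)%N by rewrite -card_G' order_dvdG.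
have mp : (m < p)%N.
  rewrite -(subnK (prime_gt0 pr_p)) addn1 ltnS pmd leq_pmulr //.
  exact: ltn_trans d_gt1.
apply/eqP; rewrite -order_eq1; have := (primeP pr_p).2 _ dp => /orP[//|/eqP gp].
by move: dm; rewrite gp => /dvdn_leq -/(_ (ltnW m_gt1)); rewrite leqNgt mp.
Qed.

(** The fixed point of one element of G' with nontrivial linear part serves
for all the groups U, by [fix_common]. *)
Lemma base_point_exists : exists x0, forall U : {group gal_of {:L}}, G' \subset U ->
  (forall g, g \in U -> gam g = 1 -> g = 1%g) -> forall g, g \in U -> aff g x0 = x0.
Proof.
have [g0 G'g0 g01] : exists2 g0, g0 \in G' & g0 != 1%g.
  by apply/trivgPn; rewrite -cardG_gt1 card_G'.
have nz : 1 - gam g0 != 0.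
  rewrite subr_eq0 eq_sym; apply: contraNneq g01 => e.
  exact/eqP/gam_inj_G'.
(* The solution of x = beta g0 + gam g0 * x. *)
exists (beta g0 / (1 - gam g0)) => U sG'U injU; apply: (fix_common injU).
- exact: (subsetP sG'U _ G'g0).
- by rewrite eq_sym -subr_eq0.
by rewrite /aff; field.
Qed.

Section BasePoint.
Variable x0 : F.
Hypothesis x0_fix : forall U : {group gal_of {:L}}, G' \subset U ->
  (forall g, g \in U -> gam g = 1 -> g = 1%g) -> forall g, g \in U -> aff g x0 = x0.

Lemma card_le_roots_of_unity (T : finType) (A : {set T}) (f : T -> F) n :
  (0 < n)%N -> {in A &, injective f} -> (forall x, x \in A -> f x ^+ n = 1) ->
  (#|A| <= n)%N.
Proof.
move=> n0 injf fn; rewrite -(card_in_imset injf) cardE.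
apply: max_unity_roots; rewrite ?enum_uniq //.
by apply/allP => y; rewrite mem_enum => /imsetP[x Ax ->]; rewrite unity_rootE fn.
Qed.

(** The elements on the right are determined by their linear part, an m-th root
of unity, so there are at most m of them; and G' has m elements. *)
Lemma mem_G' g : (g \in G') = (aff g x0 == x0) && (gam g ^+ m == 1).
Proof.
pose S := [set g | (aff g x0 == x0) && (gam g ^+ m == 1)].
suff -> : (G' : {set _}) = S by rewrite inE.
apply/eqP; rewrite eqEcard card_G'; apply/andP; split.
  apply/subsetP => h G'h; rewrite inE (x0_fix (subxx _) gam_inj_G') // eqxx /=.
  by rewrite -gamXn -card_G' expg_cardG // gam1.
apply: (@card_le_roots_of_unity _ _ gam); first exact: ltnW.
  move=> g1 g2; rewrite !inE => /andP[/eqP f1 _] /andP[/eqP f2 _] e.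
  by apply: (@aff_inj _ _ x0 e); rewrite f1 f2.
by move=> g1; rewrite inE => /andP[_ /eqP].
Qed.

(** The coordinates x and y of a coset. The choice of a representative does not
matter, because G' fixes x0 and its linear parts are m-th roots of unity
([pos_mult_lam_c1]). *)
Definition pos (X : gcoset K) := aff (repr (val X)) x0.
Definition mult (X : gcoset K) := gam (repr (val X)) ^+ m.

Lemma pos_mult_lam_c1 g :
  pos (lam g c1) = aff g x0 /\ mult (lam g c1) = gam g ^+ m.
Proof.
rewrite /pos /mult; set r := repr _.
have : r \in val (lam g c1) by rewrite lambda_repr lambda_repr_id.
rewrite val_lambda => /rcosetP[u]; rewrite mem_G' => /andP[/eqP ux /eqP um] ->.
by rewrite affM ux gamM exprMn um mul1r.
Qed.

Lemma pos_lam g X : pos (lam g X) = aff g (pos X).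
Proof.
by rewrite -(lambda_repr_id X) -permM -lambdaM !(pos_mult_lam_c1 _).1 affM.
Qed.

Lemma mult_lam g X : mult (lam g X) = gam g ^+ m * mult X.
Proof.
rewrite -(lambda_repr_id X) -permM -lambdaM !(pos_mult_lam_c1 _).2 gamM.
by rewrite mulrC exprMn.
Qed.

Lemma lambda1_c1 : lam 1%g c1 = c1.
Proof. by rewrite (lam1 (@lambdaM _ _ K)) perm1. Qed.

Lemma pos_c1 : pos c1 = x0.
Proof. by rewrite -lambda1_c1 (pos_mult_lam_c1 _).1 aff1. Qed.

Lemma mult_c1 : mult c1 = 1.
Proof. by rewrite -lambda1_c1 (pos_mult_lam_c1 _).2 gam1 expr1n. Qed.

Lemma coset_eq X Y : pos X = pos Y -> mult X = mult Y -> X = Y.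
Proof.
rewrite -(lambda_repr_id X) -(lambda_repr_id Y).
move: (repr _) (repr _) => s r.
rewrite !(pos_mult_lam_c1 _).1 !(pos_mult_lam_c1 _).2 => e1 e2.
have : (r * s^-1)%g \in G'.
  rewrite mem_G' affM e1 -affM mulgV aff1 eqxx gamM gamV exprMn e2 exprVn.
  by rewrite divff ?eqxx ?expf_neq0 ?gam_neq0.
by rewrite -lambda_c1 => /eqP e; rewrite -(mulgKV s r) lambdaM permM e.
Qed.

Lemma multX X : mult X ^+ d = 1.
Proof. by rewrite /mult -exprM gamX. Qed.

Lemma mult_neq0 X : mult X != 0.
Proof. by rewrite expf_neq0 ?gam_neq0. Qed.

Let W : {set F} := [set w | w ^+ d == 1].

(** The coordinates embed the p d cosets in the product of F and the set of d-th
roots of unity, which has at most p d elements; so this embedding is onto. *)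
Lemma card_roots : #|W| = d /\ forall x w, w ^+ d = 1 -> exists X, pos X = x /\ mult X = w.
Proof.
have d0 : (0 < d)%N by apply: ltnW.
have leW : (#|W| <= d)%N.
  by apply: (@card_le_roots_of_unity _ _ id) => // w; rewrite inE => /eqP.
pose f X := (pos X, mult X).
have injf : injective f by move=> X Y [e1 e2]; apply: coset_eq.
have sf : f @: setT \subset setX setT W.
  by apply/subsetP => _ /imsetP[X _ ->]; rewrite !inE /= multX eqxx.
have cf : #|f @: setT| = (p * d)%N by rewrite card_imset // cardsT card_coset.
have cX : #|setX [set: F] W| = (p * #|W|)%N by rewrite cardsX cardsT card_F.
have cW : #|W| = d.
  apply/eqP; rewrite eqn_leq leW /=.
  by have := subset_leq_card sf; rewrite cf cX leq_pmul2l ?prime_gt0.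
split=> // x w wd.
have /eqP fW : f @: setT == setX setT W by rewrite eqEcard sf cf cX cW leqnn.
have : (x, w) \in f @: setT by rewrite fW !inE /= wd eqxx.
by case/imsetP => X _ [-> ->]; exists X.
Qed.

Lemma prim_root_exists : exists z : F, d.-primitive_root z.
Proof.
have : has d.-primitive_root (enum W).
  apply: has_prim_root; rewrite ?enum_uniq ?(ltnW d_gt1) //.
    by apply/allP => w; rewrite mem_enum inE unity_rootE.
  by rewrite -cardE card_roots.1.
by case/hasP => z _; exists z.
Qed.

Lemma perm_of_coords (f1 f2 : F -> F -> F) :
    (forall x y, y ^+ d = 1 -> f2 x y ^+ d = 1) ->
    (forall x y x' y', y != 0 -> y' != 0 ->
       f1 x y = f1 x' y' -> f2 x y = f2 x' y' -> x = x' /\ y = y') ->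
  exists s : {perm gcoset K}, forall X,
    pos (s X) = f1 (pos X) (mult X) /\ mult (s X) = f2 (pos X) (mult X).
Proof.
move=> f2d injf.
have /fin_all_exists[h hE] : forall X, exists Y,
    pos Y = f1 (pos X) (mult X) /\ mult Y = f2 (pos X) (mult X).
  by move=> X; apply: card_roots.2; rewrite f2d // multX.
have injh : injective h.
  move=> X Y hXY; have [h1 h2] := hE X; have [h3 h4] := hE Y.
  have [||||e1 e2] := injf (pos X) (mult X) (pos Y) (mult Y).
  - exact: mult_neq0.
  - exact: mult_neq0.
  - by rewrite -h1 -h3 hXY.
  - by rewrite -h2 -h4 hXY.
  exact: coset_eq.
by exists (perm injh) => X; rewrite permE.
Qed.

Section Shear.
Variable j : nat.
Implicit Type n : {perm gcoset K}.

Definition shift n := pos ((n : {perm gcoset K}) c1) - x0.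
Definition scale n := mult ((n : {perm gcoset K}) c1).

(** The maps (x, y) |-> (x + y^j a, w y). The parameters a and w are read off
at the base coset, which has coordinates (x0, 1). *)
Definition shear_set : {set {perm gcoset K}} :=
  [set n : {perm gcoset K} | [forall X, (pos (n X) == pos X + mult X ^+ j * shift n)
                   && (mult (n X) == scale n * mult X)]].

Lemma shear_setP n : reflect
  (exists a w, forall X, pos (n X) = pos X + mult X ^+ j * a /\ mult (n X) = w * mult X)
  (n \in shear_set).
Proof.
apply: (iffP idP) => [|[a [w nE]]].
  rewrite inE => /forallP nE; exists (shift n), (scale n) => X.
  by have /andP[/eqP-> /eqP->] := nE X.
have aE : shift n = a.
  rewrite /shift (nE c1).1 pos_c1 mult_c1 expr1n mul1r addrC; ring.
have wE : scale n = w by rewrite /scale (nE c1).2 mult_c1 mulr1.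
by rewrite inE; apply/forallP => X; rewrite aE wE (nE X).1 (nE X).2 !eqxx.
Qed.

Lemma shear_pos n X : n \in shear_set -> pos (n X) = pos X + mult X ^+ j * shift n.
Proof. by rewrite inE => /forallP/(_ X)/andP[/eqP-> _]. Qed.

Lemma shear_mult n X : n \in shear_set -> mult (n X) = scale n * mult X.
Proof. by rewrite inE => /forallP/(_ X)/andP[_ /eqP->]. Qed.

Lemma shear_eq n n' : n \in shear_set -> n' \in shear_set ->
  shift n = shift n' -> scale n = scale n' -> n = n'.
Proof.
move=> Nn Nn' e1 e2; apply/permP => X; apply: coset_eq.
  by rewrite !shear_pos // e1.
by rewrite !shear_mult // e2.
Qed.

Lemma scaleX n : scale n ^+ d = 1. Proof. exact: multX. Qed.
Lemma scale_neq0 n : scale n != 0. Proof. exact: mult_neq0. Qed.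

Lemma shear_exists a w : w ^+ d = 1 ->
  exists n, [/\ n \in shear_set, shift n = a & scale n = w].
Proof.
move=> wd; have w0 : w != 0.
  by apply: contra_eq_neq wd => ->; rewrite expr0n eqn0Ngt ltnW //= eq_sym oner_eq0.
have [||s sE] := @perm_of_coords (fun x y => x + y ^+ j * a) (fun x y => w * y).
- by move=> x y yd; rewrite exprMn wd yd mulr1.
- by move=> x y x' y' _ _ + /(mulfI w0) e; rewrite e => /addIr.
have Ns : s \in shear_set by apply/shear_setP; exists a, w.
exists s; split=> //; last by rewrite /scale (sE c1).2 mult_c1 mulr1.
by rewrite /shift (sE c1).1 pos_c1 mult_c1 expr1n mul1r addrC addKr.
Qed.

Lemma shear_group_set : group_set shear_set.
Proof.
apply/group_setP; split=> [|n n' Nn Nn'].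
  by apply/shear_setP; exists 0, 1 => X; rewrite perm1 mulr0 addr0 mul1r.
apply/shear_setP; exists (shift n + scale n ^+ j * shift n'), (scale n' * scale n).
move=> X; rewrite permM !shear_pos // !shear_mult //.
by rewrite exprMn; split; ring.
Qed.

Definition shear : {group {perm gcoset K}} := Group shear_group_set.

Lemma shift1 : shift 1%g = 0.
Proof. by rewrite /shift perm1 pos_c1 subrr. Qed.

Lemma scale1 : scale 1%g = 1.
Proof. by rewrite /scale perm1 mult_c1. Qed.

Lemma shiftM n n' : n \in shear_set -> n' \in shear_set ->
  shift (n * n')%g = shift n + scale n ^+ j * shift n'.
Proof.
move=> Nn Nn'; rewrite {1}/shift permM shear_pos // -/(scale n) /shift; ring.
Qed.

Lemma scaleM n n' : n' \in shear_set -> scale (n * n')%g = scale n * scale n'.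
Proof. by move=> Nn'; rewrite {1}/scale permM shear_mult // mulrC. Qed.

Lemma shear_regular : regular_subgroup shear.
Proof.
move=> X Y.
have wd : (mult Y / mult X) ^+ d = 1 by rewrite expr_div_n !multX divr1.
have [n [Nn nE1 nE2]] := shear_exists ((pos Y - pos X) / mult X ^+ j) wd.
have nz := mult_neq0 X; have nzj : mult X ^+ j != 0 by rewrite expf_neq0.
exists n; split.
  split=> //; apply: coset_eq.
    by rewrite shear_pos // nE1 mulrC divfK // addrC subrK.
  by rewrite shear_mult // nE2 divfK.
move=> n' [Nn' n'X]; apply: shear_eq => //.
  by rewrite nE1 -n'X shear_pos // addrC addKr [mult X ^+ j * _]mulrC mulfK.
by rewrite nE2 -n'X shear_mult // mulfK.
Qed.

(** With lambda g acting by (x, y) |-> (b + c x, c^m y), conjugation multiplies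
the parameter a by c (c^m)^-j. *)
Lemma shear_conj g n : n \in shear_set ->
  [/\ (n ^ lam g)%g \in shear_set,
      shift (n ^ lam g)%g = gam g * (gam g ^+ m) ^- j * shift n
    & scale (n ^ lam g)%g = scale n].
Proof.
move=> Nn; set n' := (n ^ lam g)%g.
have nzg := gam_neq0 g; have nzm : gam g ^+ m != 0 by rewrite expf_neq0.
have n'E X : pos (n' X) = pos X + mult X ^+ j * (gam g * (gam g ^+ m) ^- j * shift n)
    /\ mult (n' X) = scale n * mult X.
  have -> : X = lam g (lam g^-1%g X).
    by rewrite -permM -lambdaM mulVg (lam1 (@lambdaM _ _ K)) perm1.
  move: (lam _ X) => Y; rewrite -lambda_perm !pos_lam !mult_lam.
  rewrite shear_pos // shear_mult // exprMn; split; last by ring.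
  rewrite /aff; field; exact: expf_neq0.
have Nn' : n' \in shear_set by apply/shear_setP; eexists; eexists; apply: n'E.
split=> //; first by rewrite {1}/shift (n'E c1).1 pos_c1 mult_c1 expr1n mul1r addrC addKr.
by rewrite {1}/scale (n'E c1).2 mult_c1 mulr1.
Qed.

Lemma shear_normalized : normalized_by_lambda shear.
Proof.
apply/subsetP => _ /imsetP[g _ ->]; rewrite inE; apply/subsetP => _ /imsetP[n Nn ->].
by have [] := shear_conj g Nn.
Qed.

Lemma card_shear : #|shear| = (p * d)%N.
Proof. by rewrite (card_regular galL shear_regular) -card_coset card_gcoset. Qed.

(** If U contains a nontrivial translation, it contains them all; otherwise it
fixes x0. Take the elements whose parameter w is the m-th power of a linear part
of U, with a arbitrary in the first case and a = 0 in the second one. Both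
conditions are invariant under conjugation by lambda(G). *)
Lemma shear_stable (U : {group gal_of {:L}}) : G' \subset U ->
  exists N' : {group {perm gcoset K}},
    [/\ N' \subset shear, forall g, lam g \in 'N(N')%g & coset_stab N' = U].
Proof.
move=> sG'U.
pose full := [exists t in U, (gam t == 1) && (t != 1%g)].
have fullU : full -> forall u, gam u = 1 -> u \in U.
  case/existsP => t /and3P[Ut /eqP t1 nt] u u1.
  by have [n ->] := transl_expg t1 nt u1; apply: groupX.
have fixU : ~~ full -> forall u, u \in U -> aff u x0 = x0.
  rewrite negb_exists => /forallP inj; apply: x0_fix => // u Uu u1.
  by apply/eqP; have := inj u; rewrite Uu u1 eqxx /= negbK.
pose T := [set n in shear_set | (full || (shift n == 0))
                                && [exists u in U, gam u ^+ m == scale n]].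
have TP n : reflect [/\ n \in shear_set, full || (shift n == 0)
    & exists2 u, u \in U & gam u ^+ m = scale n] (n \in T).
  rewrite !inE; apply: (iffP and3P).
    move=> [Nn f /existsP[u /andP[Uu /eqP e]]].
    by split=> //; exists u.
  move=> [Nn f [u Uu /eqP e]].
  by split=> //; apply/existsP; exists u; rewrite Uu.
have gT : group_set T.
  apply/group_setP; split=> [|n n' /TP[Nn f [u Uu e]] /TP[Nn' f' [u' Uu' e']]]; apply/TP.
    split; first exact: group1 shear.
      by rewrite shift1 eqxx orbT.
    by exists 1%g; rewrite ?group1 // gam1 expr1n scale1.
  split; first exact: (groupM (G := shear)).
    case/orP: f => [->//|/eqP s0]; case/orP: f' => [->//|/eqP s0'].
    by rewrite shiftM // s0 s0' mulr0 addr0 eqxx orbT.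
  by exists (u * u')%g; rewrite ?groupM // scaleM // gamM exprMn e e'.
exists (Group gT); split.
- by apply/subsetP => n /TP[].
- move=> g; rewrite inE; apply/subsetP => _ /imsetP[n /TP[Nn f [u Uu e]] ->].
  have [Nn' shE scE] := shear_conj g Nn; apply/TP; split=> //.
    by case/orP: f => [->//|/eqP s0]; rewrite shE s0 mulr0 eqxx orbT.
  by exists u; rewrite // scE.
apply/setP => g; apply/coset_stabP/idP => [[n /TP[Nn f [u Uu e]] nE]|Ug].
  have eg : gam g ^+ m = gam u ^+ m.
    by rewrite -(pos_mult_lam_c1 g).2 -nE e.
  have gu_md : (gam (g * u^-1)%g) ^+ (m * d) = 1 by apply: gamX.
  (* s has the linear part of g * u^-1 and fixes x0, so it belongs to G'. *)
  have [s [bs gs]] := bg_surj (x0 - gam (g * u^-1)%g * x0) gu_md.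
  have G's : s \in G'.
    rewrite mem_G' /aff bs gs subrK eqxx /= gamM gamV exprMn eg exprVn.
    by rewrite divff ?expf_neq0 ?gam_neq0.
  have Us := subsetP sG'U s G's.
  have -> : g = ((g * u^-1 * s^-1) * s * u)%g by rewrite !mulgKV.
  have t1 : gam (g * u^-1 * s^-1)%g = 1 by rewrite gamM gamV gs divff ?gam_neq0.
  apply: (groupM _ Uu); apply: (groupM _ Us).
  case: (boolP full) => [fu|nfull]; first exact: fullU fu _ t1.
  have fixg : aff g x0 = x0.
    have := f; rewrite (negPf nfull) /shift nE (pos_mult_lam_c1 g).1 /=.
    by rewrite subr_eq0 => /eqP.
  suff -> : (g * u^-1 * s^-1)%g = 1%g by apply: group1.
  apply: (@aff_inj _ _ x0); first by rewrite t1 gam1.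
  have fixV v : v \in U -> aff v^-1%g x0 = x0 by move=> Uv; rewrite aff_fixV ?fixU.
  by rewrite aff1 !affM fixg !fixV.
have [|n [Nn shE scE]] := @shear_exists (aff g x0 - x0) (gam g ^+ m).
  by rewrite -exprM gamX.
exists n; last first.
  apply: coset_eq; rewrite ?(pos_mult_lam_c1 g).1 ?(pos_mult_lam_c1 g).2 -?scE //.
  by apply: (addIr (- x0)); rewrite -shE.
apply/TP; split=> //; last by exists g.
by case: (boolP full) => //= /fixU/(_ _ Ug) fg; rewrite shE fg subrr.
Qed.

(** For a primitive d-th root of unity z, the map
(x, y) |-> (x0 + z^j (x - x0), z y) centralizes the group; if it is the lambda of
an element of linear part c, then c = z^j and c^m = z, so m j = 1 modulo d.
Conversely, a permutation s of the centralizer maps the base coset to the same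
point as some lambda g with c = w^j, where w is the second coordinate of that
point. Since c^m = w, we get c = (c^m)^j, so by [shear_conj] lambda g centralizes
the group too. Two such permutations that agree at a point are equal by
transitivity. *)
Lemma shear_almost_classical :
  almost_classical shear <-> (m * j = 1 %[mod d])%N.
Proof.
have [z prz] := prim_root_exists.
have z_d : z ^+ d = 1 := prim_expr_order prz.
have z0 : z != 0.
  by apply: contra_eq_neq z_d => ->; rewrite expr0n eqn0Ngt ltnW //= eq_sym oner_eq0.
split=> [acl|mj1].
  have [||s sE] := @perm_of_coords (fun x y => x0 + z ^+ j * (x - x0)) (fun x y => z * y).
  - by move=> x y yd; rewrite exprMn z_d yd mulr1.
  - move=> x y x' y' _ _ /addrI/(mulfI (expf_neq0 j z0)) /addIr-> /(mulfI z0)->.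
    by [].
  have Cs : s \in 'C(shear)%g.
    apply/centP => n Nn; apply/permP => X; rewrite !permM; apply: coset_eq.
      rewrite (sE _).1 !(shear_pos _ Nn) (sE _).1 (sE _).2 exprMn; ring.
    by rewrite (sE _).2 !(shear_mult _ Nn) (sE _).2; ring.
  have /imsetP[g _ gE] := subsetP acl s Cs.
  have g1 : gam g = z ^+ j.
    have [X [pX _]] := card_roots.2 (x0 + 1) 1 (expr1n _ _).
    have := (sE X).1; have := (sE c1).1; rewrite gE !pos_lam pX pos_c1 /aff => e1 e2.
    have e3 : gam g = (beta g + gam g * (x0 + 1)) - (beta g + gam g * x0) by ring.
    by rewrite e3 e1 e2; ring.
  have := (sE c1).2; rewrite gE mult_lam mult_c1 !mulr1 g1 -exprM mulnC.
  rewrite -[RHS](expr1 z) => /eqP; rewrite (eq_prim_root_expr prz).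
  by move/eqP.
have wmj w : w ^+ d = 1 -> w ^+ (m * j) = w.
  move=> wd; rewrite (divn_eq (m * j) d) mj1 modn_small // exprD mulnC exprM wd.
  by rewrite expr1n mul1r expr1.
apply/subsetP => s Cs; set w := mult (s c1).
have wd : w ^+ d = 1 := multX _.
have gamd : (w ^+ j) ^+ (m * d) = 1.
  by rewrite -exprM mulnA mulnC exprM wd expr1n.
have [g [bg gg]] := bg_surj (pos (s c1) - w ^+ j * x0) gamd.
have lE : lam g c1 = s c1.
  apply: coset_eq; first by rewrite (pos_mult_lam_c1 g).1 /aff bg gg subrK.
  by rewrite (pos_mult_lam_c1 g).2 gg -exprM mulnC wmj.
have lC n : n \in shear_set -> (n ^ lam g)%g = n.
  move=> Nn; have [Nn' shE scE] := shear_conj g Nn.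
  have gm : gam g ^+ m = w by rewrite gg -exprM mulnC wmj.
  apply: shear_eq => //; rewrite shE gm gg divff ?mul1r //.
  by rewrite expf_neq0 // mult_neq0.
apply/imsetP; exists g; first exact: mem_gal1.
apply/permP => X; have [n [[Nn nX] _]] := shear_regular c1 X.
by rewrite -nX lambda_perm (lC n Nn) lE -!permM (centP Cs n Nn).
Qed.

End Shear.
(** The element with parameters a and w corresponds to the affine map with
b = a w^-j and c = w^-j; the inverse makes up for the order of composition. As j
is prime to d, taking j-th powers is injective on the d-th roots of unity. *)
Lemma shear_isog (j : nat) (D : {group gal_of {:L}}) : coprime j d ->
  (forall g, (g \in D) = (gam g ^+ d == 1)) -> (shear j \isog D)%g.
Proof.
move=> cojd DE; have d0 : (0 < d)%N by apply: ltnW.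
have /fin_all_exists[f fE] : forall n : {perm gcoset K}, exists g,
    beta g = shift n / scale n ^+ j /\ gam g = (scale n ^+ j)^-1.
  move=> n; apply: bg_surj.
  by rewrite exprVn -exprM [(m * d)%N]mulnC mulnCA exprM scaleX expr1n invr1.
have nzj n : scale n ^+ j != 0 by rewrite expf_neq0 ?scale_neq0.
have fM : {in shear j &, {morph f : n n' / (n * n')%g}}.
  move=> n n' Nn Nn'; have [b1 g1] := fE n; have [b2 g2] := fE n'.
  have [b3 g3] := fE (n * n')%g.
  apply: bg_inj; rewrite ?betaM ?gamM ?b3 ?g3 ?b2 ?g2 ?b1 ?g1.
    rewrite (shiftM Nn Nn') (scaleM n Nn') exprMn; field.
    by rewrite !nzj.
  by rewrite (scaleM n Nn') exprMn invfM.
pose fm := Morphism fM.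
have [i ji] : exists i, forall w : F, w ^+ d = 1 -> (w ^+ j) ^+ i = w.
  have [j0|j0] := posnP j; first by move: cojd d_gt1; rewrite j0 /coprime gcd0n => /eqP->.
  have [[a b] /= ab] := coprimeP d j0 cojd; exists a => w wd.
  have -> : w ^+ j ^+ a = w ^+ (1 + b * d).
    by rewrite -exprM mulnC -ab subnK // ltnW // -subn_gt0 ab.
  by rewrite exprD mulnC exprM wd expr1n mulr1.
have inj_f : ('injm fm)%g.
  apply/injmP => n n' Nn Nn' /= e; have [b1 g1] := fE n; have [b2 g2] := fE n'.
  have sc : scale n = scale n'.
    rewrite -(ji _ (scaleX n)) -(ji _ (scaleX n')); congr (_ ^+ i).
    by apply: invr_inj; rewrite -g1 -g2 e.
  apply: (shear_eq Nn Nn' _ sc).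
  by apply: (mulIf (invr_neq0 (nzj n))); rewrite {2}sc -b1 -b2 e.
suff -> : (D : {set _}) = (fm @* shear j)%g by apply: sub_isog.
apply/esym/eqP; rewrite eqEcard; apply/andP; split.
  apply/subsetP => _ /morphimP[n _ Nn ->]; rewrite DE /= (fE n).2.
  by rewrite exprVn -exprM mulnC exprM scaleX expr1n invr1.
rewrite card_injm // card_shear.
have injbg : injective (fun g => (beta g, gam g)).
  by move=> g h [e1 e2]; apply: bg_inj.
rewrite -(card_imset _ injbg) -card_F -cardsT -card_roots.1 -cardsX.
apply/subset_leq_card/subsetP => _ /imsetP[g Dg ->].
by rewrite !inE /= -DE.
Qed.

Lemma pcharF : p \in [pchar F].
Proof. by rewrite inE pr_p pF eqxx. Qed.

(** For j = 0 the parameters form a direct product, so the element with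
parameters 1 and z has order p d when z is a primitive d-th root of unity. *)
Lemma shear0_cyclic : (shear 0 \isog Zp (p * d))%g.
Proof.
have [z prz] := prim_root_exists.
have [n [Nn nE zE]] := shear_exists 0 1 (prim_expr_order prz).
have nX i : shift (n ^+ i)%g = i%:R /\ scale (n ^+ i)%g = z ^+ i.
  elim: i => [|i [IH1 IH2]]; first by rewrite shift1 scale1.
  have Ni : (n ^+ i)%g \in shear_set 0 by apply: (groupX (G := shear 0)).
  rewrite expgSr (shiftM Ni Nn) (scaleM _ Nn) IH1 IH2 nE zE expr0 mul1r.
  by rewrite -exprSr -addn1 natrD.
have pd : (p * d %| #[n]%g)%N.
  have := nX #[n]%g; rewrite expg_order shift1 scale1 => -[e1 e2].
  rewrite Gauss_dvd; last first.
    rewrite prime_coprime // gtnNdvd ?(ltnW d_gt1) //.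
    rewrite -(subnK (prime_gt0 pr_p)) addn1 ltnS pmd leq_pmull //.
    exact: ltnW.
  by rewrite (dvdn_pcharf pcharF) -e1 eqxx (prim_order_dvd prz) -e2 eqxx.
have sn : <[n]>%g \subset shear 0 by rewrite cycle_subG.
have card_n : #[n]%g = (p * d)%N.
  apply/eqP; rewrite eqn_dvd pd andbT -(card_shear 0).
  exact: cardSg.
have -> : shear 0 = <[n]>%G.
  by apply/val_inj/esym/eqP; rewrite eqEcard sn card_shear -card_n leqnn.
by rewrite isog_sym -card_n Zp_isog.
Qed.

End BasePoint.

Theorem shear_family : exists N_ : nat -> {group {perm gcoset K}},
  [/\ forall j, regular_subgroup (N_ j) /\ normalized_by_lambda (N_ j),
      forall j (U : {group gal_of {:L}}), G' \subset U ->
        exists N' : {group {perm gcoset K}},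
          [/\ N' \subset N_ j, forall g, lam g \in 'N(N')%g & coset_stab N' = U],
      forall j, almost_classical (N_ j) <-> (m * j = 1 %[mod d])%N,
      (N_ 0 \isog Zp (p * d))%g
    & forall j (D : {group gal_of {:L}}), coprime j d ->
        (forall g, (g \in D) = (gam g ^+ d == 1)) -> (N_ j \isog D)%g].
Proof.
have [x0 x0_fix] := base_point_exists; exists (shear x0_fix); split.
- by move=> j; split; [apply: shear_regular | apply: shear_normalized].
- exact: shear_stable.
- exact: shear_almost_classical.
- exact: shear0_cyclic.
exact: shear_isog.
Qed.

End AffineCoordinates.

(** * Affine maps as matrices, and the theorem *)

Section FrobeniusMatrices.
Variables (p e : nat).
Local Notation b_ y := (GLval (y : {'GL_2(p)}) ord0 ord_max).
Local Notation c_ y := (GLval (y : {'GL_2(p)}) ord_max ord_max).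

Lemma lift00 : lift ord0 ord0 = ord_max :> 'I_2. Proof. exact/val_inj. Qed.

Lemma ord2P (P : 'I_2 -> Prop) : P ord0 -> P ord_max -> forall i, P i.
Proof.
move=> P0 P1 [[|[|i]] lti] //.
  by rewrite (_ : Ordinal lti = ord0) //; apply: val_inj.
by rewrite (_ : Ordinal lti = ord_max) //; apply: val_inj.
Qed.

Lemma FrobP y : y \in Frob p e ->
  [/\ GLval y ord0 ord0 = 1, GLval y ord_max ord0 = 0 & c_ y ^+ e = 1].
Proof. by rewrite inE => /and3P[/eqP ? /eqP ? /eqP ?]. Qed.

Lemma Frob_mul x y : x \in Frob p e -> y \in Frob p e ->
  b_ (x * y)%g = b_ y + b_ x * c_ y /\ c_ (x * y)%g = c_ x * c_ y.
Proof.
move=> /FrobP[x0 x1 _] /FrobP[y0 y1 _].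
rewrite !GL_MxE !mxE !big_ord_recl !big_ord0 lift00.
by rewrite x0 x1 mul0r mul1r addr0 add0r addr0.
Qed.

Lemma Frob_inj x y : x \in Frob p e -> y \in Frob p e ->
  b_ x = b_ y -> c_ x = c_ y -> x = y.
Proof.
move=> /FrobP[x0 x1 _] /FrobP[y0 y1 _] eb ec; apply: val_inj => /=.
apply/matrixP; apply: ord2P; apply: ord2P => //=.
- by rewrite [LHS]x0 [RHS]y0.
by rewrite [LHS]x1 [RHS]y1.
Qed.

Lemma Frob_surj (b c : 'F_p) : (0 < e)%N -> c ^+ e = 1 ->
  exists2 y, y \in Frob p e & b_ y = b /\ c_ y = c.
Proof.
move=> e0 ce; pose M : 'M['F_p]_2 :=
  \matrix_(i, j) if i == ord0 then if j == ord0 then 1 else b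
                 else if j == ord0 then 0 else c.
have uM : M \is a GRing.unit.
  rewrite -[_ \is a _]/(M \in unitmx) unitmxE (expand_det_col _ ord0).
  rewrite !big_ord_recl big_ord0 lift00 !mxE /= mul0r !addr0 mul1r.
  rewrite /cofactor det_mx11 !mxE /= expr0 mul1r unitfE.
  apply: contra_eq_neq ce => ->.
  by rewrite expr0n eqn0Ngt e0 eq_sym oner_eq0.
pose y : {'GL_2(p)} := insubd (1%g : {'GL_2(p)}) M.
have yM : GLval y = M by apply: insubdK.
by exists y; rewrite ?inE !yM !mxE /= ?ce ?eqxx.
Qed.

End FrobeniusMatrices.

Lemma prime_Fp_expr p (c : 'F_p) : prime p -> c != 0 -> c ^+ (p - 1) = 1.
Proof.
move=> pr_p c0; apply: (mulfI c0); rewrite mulr1 -exprS subn1 prednK ?prime_gt0 //.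
by have := expf_card c; rewrite [#|_|](card_Fp pr_p).
Qed.

Local Close Scope ring_scope.

Theorem theorem3p4 (p d : nat) (k : fieldType) (L : splittingFieldType k)
    (K : {subfield L}) :
  prime p -> 5 <= p -> d %| p - 1 -> 1 < d < p - 1 ->
  separable 1%VS K -> \dim K = p * d ->
  is_galois_closure K -> ('Gal({:L} / 1) \isog Frob p (p - 1))%g ->
  (exists (H : hopfAlg k) (S : hopfGalois H (subvs_of K))
          (N : {group {perm gcoset K}}),
      [/\ given_by S N, (N \isog Zp (p * d))%g, ~ almost_classical N
        & galois_corr_bijective S])
  /\
  (exists (H : hopfAlg k) (S : hopfGalois H (subvs_of K))
          (N : {group {perm gcoset K}}),
      [/\ given_by S N, (N \isog Frob p d)%g, galois_corr_bijective S
        & almost_classical N <-> gcdn ((p - 1) %/ d) d = 1]).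
Proof.
move=> pr_p p5 d_p1 /andP[d_gt1 d_ltp1] sepK dimK [galL _] /isogP[f injf fG].
set m := (p - 1) %/ d.
have p1md : p - 1 = m * d by rewrite divnK.
have m_gt1 : 1 < m.
  by rewrite ltn_divRL // mul1n.
have p1_gt0 : 0 < p - 1 by apply: leq_trans d_ltp1.
have Gf g : f g \in Frob p (p - 1) by rewrite -fG mem_morphim ?mem_gal1.
pose beta g := GLval (f g) ord0 ord_max.
pose gam g := GLval (f g) ord_max ord_max.
have fM g h : f (g * h)%g = (f g * f h)%g by rewrite morphM ?mem_gal1.
have gamM g h : gam (g * h)%g = (gam g * gam h)%R.
  by rewrite /gam fM (Frob_mul (Gf g) (Gf h)).2.
have betaM g h : beta (g * h)%g = (beta h + beta g * gam h)%R.
  by rewrite /beta fM (Frob_mul (Gf g) (Gf h)).1.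
have bg_inj g h : beta g = beta h -> gam g = gam h -> g = h.
  move=> eb eg; apply: (injmP injf); rewrite ?mem_gal1 //.
  exact: Frob_inj (Gf g) (Gf h) eb eg.
have gamX g : (gam g ^+ (m * d) = 1)%R.
  by have [_ _] := FrobP (Gf g); rewrite -p1md.
have bg_surj b c : (c ^+ (m * d) = 1)%R -> exists g, beta g = b /\ gam g = c.
  rewrite -p1md => /(Frob_surj b p1_gt0)[y]; rewrite -fG.
  by case/morphimP => g _ _ -> [eb ec]; exists g.
have cardF : #|'F_p| = p by apply: card_Fp.
have natF (x : 'F_p) : exists n, (x = n%:R)%R by exists x; rewrite natr_Zp.
have pF : (p%:R = 0 :> 'F_p)%R by apply: pchar_Fp_0.
have card_coset : #|{: gcoset K}| = p * d by rewrite card_gcoset.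
have card_G : #|[set: gal_of {:L}]| = p * (p - 1).
  have injbg : injective (fun g => (beta g, gam g)).
    by move=> g h [e1 e2]; apply: bg_inj.
  have imbg : (fun g => (beta g, gam g)) @: setT = setX setT [set~ 0%R].
    apply/setP => -[b c]; rewrite !inE /=; apply/imsetP/idP => [[g _ [_ ->]]|c0].
      apply: contra_eq_neq (gamX g) => ->.
      by rewrite expr0n eqn0Ngt -p1md p1_gt0 eq_sym oner_eq0.
    have [|g [<- <-]] := bg_surj b c; last by exists g; rewrite ?inE.
    by rewrite -p1md prime_Fp_expr.
  by rewrite -(card_imset _ injbg) imbg cardsX cardsT cardsC1 cardF subn1.
have card_G' : #|'Gal({:L} / K)%g| = m.
  have : (\dim {:L} = #|'Gal({:L} / K)%g| * \dim K)%N.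
    by rewrite -(galois_dim (galKL K galL)) -dim_sup_field ?subvf.
  have -> : \dim {:L} = p * (p - 1).
    rewrite -card_G -(Gal_setT L) -(galois_dim galL) dimv1 divn1 //.
  rewrite dimK p1md mulnCA => /eqP; rewrite eqn_pmul2r; first by move/eqP.
  by rewrite muln_gt0 prime_gt0 // ltnW.
have [N_ [regnorm stable acl cyc iso]] := shear_family galL pr_p m_gt1 d_gt1 p1md
  cardF natF pF gamM betaM bg_inj gamX bg_surj card_G' card_coset.
have HGS j : exists (H : hopfAlg k) (S : hopfGalois H (subvs_of K)),
    given_by S (N_ j) /\ galois_corr_bijective S.
  have [reg norm] := regnorm j.
  have [H [S [gS corr]]] := hopfGalois_of_regular galL reg norm.
  by exists H, S; split=> //; apply: corr; apply: stable.
split.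
  have [H [S [gS corr]]] := HGS 0.
  exists H, S, (N_ 0); split=> //.
  by rewrite acl muln0 mod0n modn_small.
(* If m has no inverse modulo d, no j makes the structure almost classical, and
   j = 1 only has to be prime to d. *)
have [j coj mj] : exists2 j, coprime j d & (m * j = 1 %[mod d] <-> gcdn m d = 1).
  have [co|nco] := boolP (coprime m d); last first.
    exists 1; rewrite ?coprime1n // muln1; split=> m1; last by move: nco; rewrite /coprime m1.
    by move: nco; rewrite -coprime_modl m1 coprime_modl coprime1n.
  have [[a b] /= ab] := coprimeP d (ltnW m_gt1) co.
  have mE : m * a = 1 + b * d.
    by rewrite mulnC -ab subnK // ltnW // -subn_gt0 ab.
  exists a; last by split=> _; [apply/eqP | rewrite mE addnC modnMDl].
  have : coprime (m * a) d by rewrite mE -coprime_modl addnC modnMDl coprime_modl coprime1n.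
  by rewrite coprimeMl => /andP[].
have [H [S [gS corr]]] := HGS j; exists H, S, (N_ j); split=> //; last by rewrite acl.
have dfr : Frob p d \subset Frob p (p - 1).
  apply/subsetP => y; rewrite !inE => /and3P[-> -> /eqP yd] /=.
  by rewrite p1md mulnC GRing.exprM yd GRing.expr1n.
have imD : (f @* (f @*^-1 Frob p d) = Frob p d)%g by rewrite morphpreK // fG.
apply: (@isog_trans _ _ _ _ [group of (f @*^-1 Frob p d)%g]).
  apply: iso => // g; rewrite !inE mem_gal1 /=.
  by have [-> -> _] := FrobP (Gf g); rewrite !eqxx.
rewrite -[X in _ \isog X]imD; apply: sub_isog => //.
exact: subsetIl.
Qed.
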